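(* $Z^{RB}=Z^{\sqcup\!\sqcup}$ as maps $\mathcal{H}^{\sqcup\!\sqcup}_1\to\mathbb{C}[T]$. In particular, the restriction of $Z^{RB}$ to $\mathcal{H}^{\sqcup\!\sqcup}_0$ agrees with $\zeta^{\sqcup\!\sqcup}$.
   Context: Shuffle algebra: words in letters $x_0,x_1$ with $1\sqcup\!\sqcup w=w\sqcup\!\sqcup1=w$, $(au)\sqcup\!\sqcup(bv)=a(u\sqcup\!\sqcup bv)+b(au\sqcup\!\sqcup v)$. $\mathcal{H}^{\sqcup\!\sqcup}_1=\mathbb{Q}\oplus\mathcal{H}^{\sqcup\!\sqcup}_{1,+}$, where $\mathcal{H}^{\sqcup\!\sqcup}_{1,+}$ is the $\mathbb{Q}$-span of the words $x_0^{s_1-1}x_1\cdots x_0^{s_k-1}x_1$ ($k\ge1$, $s_i\ge1$); $\mathcal{H}^{\sqcup\!\sqcup}_0\subseteq\mathcal{H}^{\sqcup\!\sqcup}_1$ is $\mathbb{Q}$ plus the span of such words with $s_1\ge2$. $\zeta^{\sqcup\!\sqcup}:\mathcal{H}^{\sqcup\!\sqcup}_0\to\mathbb{R}$ is the linear map $1\mapsto1$, $x_0^{s_1-1}x_1\cdots x_0^{s_k-1}x_1\mapsto\zeta(s_1,\dots,s_k)=\sum_{n_1>\cdots>n_k\ge1}n_1^{-s_1}\cdots n_k^{-s_k}$; it is an algebra homomorphism for $\sqcup\!\sqcup$, and $\mathcal{H}^{\sqcup\!\sqcup}_1=\mathcal{H}^{\sqcup\!\sqcup}_0[x_1]$ is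 a polynomial algebra in $x_1$ over $\mathcal{H}^{\sqcup\!\sqcup}_0$ for $\sqcup\!\sqcup$. $Z^{\sqcup\!\sqcup}:\mathcal{H}^{\sqcup\!\sqcup}_1\to\mathbb{R}[T]\subseteq\mathbb{C}[T]$ is the unique algebra homomorphism extending $\zeta^{\sqcup\!\sqcup}$ with $x_1\mapsto T$. Definition of $Z^{RB}$: let $\mathcal{H}_{\ge1,+}$ be the $\mathbb{Q}$-space with basis $[s_1,\dots,s_k]$ ($k\ge1$, $s_i\ge1$), and $\eta:\mathcal{H}^{\sqcup\!\sqcup}_{1,+}\to\mathcal{H}_{\ge1,+}$, $x_0^{s_1-1}x_1\cdots x_0^{s_k-1}x_1\mapsto[s_1,\dots,s_k]$. Let $\phi$ be the map $[s_1,\dots,s_k]\mapsto Li_{(s_1,\dots,s_k)}(e^{\varepsilon})=\sum_{n_1>\cdots>n_k\ge1}\frac{e^{n_1\varepsilon}}{n_1^{s_1}\cdots n_k^{s_k}}$, a function of $\varepsilon\in(-\infty,0)$ (equivalently, the unique Rota–Baxter homomorphism sending $[0]\mapsto e^{\varepsilon}/(1-e^{\varepsilon})$, restricted). For each $w\in\mathcal{H}^{\sqcup\!\sqcup}_{1,+}$ the function $\phi(\eta(w))$ coincides near $\varepsilon=0^-$ with $\sum_{j=0}^m c_j(\varepsilon)(-\ln(-\varepsilon))^j$ for convergent power series $c_j(\varepsilon)\in\mathbb{C}\{\{\varepsilon\}\}$ (nonnegative powers only), and these $c_j$ are unique because $\ln(-\varepsilon)$ is transcendental over convergent Laurent series.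 Set $Z^{RB}(w)=\sum_j c_j(0)T^j\in\mathbb{C}[T]$ (i.e. replace $-\ln(-\varepsilon)$ by $T$ and then set $\varepsilon=0$), and extend to $\mathcal{H}^{\sqcup\!\sqcup}_1$ by $Z^{RB}(1)=1$ and linearity. *)

(* Defs.v *)
From HB Require Import structures.
From mathcomp Require Import all_boot all_order all_algebra finmap complex.
From mathcomp.multinomials Require Import monalg.
From mathcomp Require Import all_classical all_reals.
From mathcomp Require Import ereal topology normedtype sequences esum exp.

Set Implicit Arguments.
Unset Strict Implicit.
Unset Printing Implicit Defensive.

Import Order.TTheory GRing.Theory Num.Theory numFieldNormedType.Exports.

Local Open Scope classical_set_scope.
Local Open Scope ring_scope.

Definition letter : Type := bool.
Definition x0 : letter := false.
Definition x1 : letter := true.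
Definition word : Type := seq letter.

(* [{malg rat[word]}] is only used as the free Q-vector space on words: [word]
   carries no [monomType] structure, so no product is implied.  The map [<< >>]
   sends a word to its basis vector. *)
Notation Hsh := {malg rat[word]}.

Fixpoint shuffle_word (u : word) : word -> seq word :=
  match u with
  | [::] => fun v => [:: v]
  | a :: u' =>
    fix shuffle_u v :=
      match v with
      | [::] => [:: u]
      | b :: v' => map (cons a) (shuffle_word u' v) ++ map (cons b) (shuffle_u v')
      end
  end.

(* [shuffle_word u v] lists the words of the shuffle of u and v with
   multiplicity; [shuffle] is its bilinear extension. *)
Definition shuffle (f g : Hsh) : Hsh :=
  \sum_(u <- msupp f) \sum_(v <- msupp g) \sum_(w <- shuffle_word u v)
    << f@_u * g@_v *g w >>.

(* A sequence [:: s_1; ...; s_k] of nat stands for (s_1, ..., s_k). *)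
Definition composition (s : seq nat) : bool := all (leq 1) s.

Definition word_of_comp (s : seq nat) : word :=
  flatten [seq rcons (nseq n.-1 x0) x1 | n <- s].

(* The inverse of [word_of_comp]; [n] counts the letters x0 read since the last
   letter x1. *)
Fixpoint comp_of_word_rec (n : nat) (w : word) : seq nat :=
  match w with
  | [::] => [::]
  | a :: w' => if a == x1 then n.+1 :: comp_of_word_rec 0 w'
               else comp_of_word_rec n.+1 w'
  end.

Definition comp_of_word : word -> seq nat := comp_of_word_rec 0.

Lemma word_of_compK (s : seq nat) :
  composition s -> comp_of_word (word_of_comp s) = s.
Proof.
have nseqK m k w : comp_of_word_rec k (rcons (nseq m x0) x1 ++ w) =
    (k + m).+1 :: comp_of_word_rec 0 w.
  elim: m k => [|m IH] k; first by rewrite addn0.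
  by rewrite /= IH addSnnS.
elim: s => [//|n s IH] /= /andP[n0 /IH sK].
by rewrite /comp_of_word /word_of_comp /= nseqK add0n prednK // -[in RHS]sK.
Qed.

(* Spans are given by a condition on the support.  The empty composition is
   allowed, which accounts for the summand Q. *)
Definition H1 : set Hsh :=
  [set f | forall w, w \in msupp f ->
    exists2 s, composition s & w = word_of_comp s].

Definition H0 : set Hsh :=
  [set f | forall w, w \in msupp f ->
    exists2 s, composition s /\ (s = [::] \/ (2 <= head 0%N s)%N)
             & w = word_of_comp s].

Definition eta (f : Hsh) : {malg rat[seq nat]} :=
  \sum_(w <- msupp f) << f@_w *g comp_of_word w >>.

Section Zeta.
Variable R : realType.

Definition decreasing_indices (k : nat) : set (seq nat) :=
  [set n | [/\ size n = k, sorted gtn n & all (leq 1) n]].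

Definition comp_term (s n : seq nat) : R :=
  \prod_(p <- zip n s) (p.1%:R ^- p.2).

(* The terms of the series below are nonnegative, so that they can be summed in
   [\bar R] with [esum].  The value [mzv [::]] is 1: the only index is the empty
   sequence, with an empty product. *)
Definition mzv (s : seq nat) : R :=
  fine (\esum_(n in decreasing_indices (size s)) (comp_term s n)%:E).

Definition Li_exp (s : seq nat) (e : R) : R :=
  fine (\esum_(n in decreasing_indices (size s))
          (expR ((head 0%N n)%:R * e) * comp_term s n)%:E).

Definition zeta_sh (f : Hsh) : R :=
  mmap ratr (fun w => mzv (comp_of_word w)) f.

(* An algebra homomorphism from H1 to R[T] extending [zeta_sh] and mapping x1
   to T; only the values of [Z] on H1 are constrained. *)
Definition shuffle_regularization (Z : Hsh -> {poly R}) : Prop :=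
  [/\ forall (a : rat) f g, H1 f -> H1 g ->
        Z (a *: f + g) = ratr a *: Z f + Z g,
      Z << [::] >> = 1,
      forall f g, H1 f -> H1 g -> Z (shuffle f g) = Z f * Z g,
      forall f, H0 f -> Z f = (zeta_sh f)%:P
    & Z << [:: x1] >> = 'X].

Definition Zsh : Hsh -> {poly R} :=
  xget (fun=> 0) [set Z | shuffle_regularization Z].

Definition phi (g : {malg rat[seq nat]}) (e : R) : R :=
  mmap ratr (fun s => Li_exp s e) g.

(* The regular algebra [R[i]^o] carries the usual topology of the complex
   numbers in the library. *)
Definition power_series (c : nat -> R[i]) (z : R[i]) : R[i]^o ^nat :=
  series (fun n => c n * z ^+ n : R[i]^o).

Definition convergent_power_series (c : nat -> R[i]) : Prop :=
  exists2 r : R, 0 < r &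
    forall z : R[i], `|z| < r%:C%C -> cvgn (power_series c z).

Definition log_expansion (h : R -> R) (m : nat) (c : nat -> nat -> R[i]) : Prop :=
  (forall j, (j <= m)%N -> convergent_power_series (c j)) /\
  \forall e \near 0^'-,
    (h e)%:C%C =
    \sum_(j < m.+1) limn (power_series (c j) (e%:C)%C) * ((- ln (- e)) ^+ j)%:C%C.

(* [c j 0] is the value at 0 of the power series [c j]. *)
Definition regularized_value (h : R -> R) : set {poly R[i]} :=
  [set p | exists m c, log_expansion h m c /\ p = \poly_(j < m.+1) c j 0%N].

Definition ZRB_plus (f : Hsh) : {poly R[i]} :=
  xget 0 (regularized_value (phi (eta f))).

(* [f@_[::]] is the component of f along 1 in the decomposition of H1 as the
   direct sum of Q and the span of the nonempty words. *)
Definition ZRB (f : Hsh) : {poly R[i]} :=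
  (ratr f@_([::] : word))%:P + ZRB_plus (f - << f@_([::] : word) *g [::] >>).

End Zeta.

(* Main.v *)
(** Let Li_w(z) = sum_n a_w(n) z^n be the polylogarithm of a word w and
   L = - ln(-t).  The coefficients a_w satisfy a recursion which turns the
   shuffle product into the Cauchy product, so that w |-> Li_w(e^t), t < 0, is a
   homomorphism for the shuffle product.  The differential equation
   d/dt Li_(l w)(e^t) = k_l(t) Li_w(e^t), with k_(x0) = 1 and
   k_(x1) = e^t/(1 - e^t) = - 1/t + O(1), is solved termwise by integration by
   parts and gives by induction an expansion sum_j c_j(t) L^j with c_j
   convergent power series.  Since c_j(t) L^j = c_j(0) L^j + o(L^-k) for all k,
   the polynomial sum_j c_j(0) T^j is determined by the function and depends
   multiplicatively on it.  Hence Z^RB is a shuffle homomorphism; it maps x1 to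
   T because Li_(x1)(e^t) = - ln(1 - e^t) = L + o(1), and w to the limit zeta(w),
   by monotone convergence, if w begins with x0, for which the 1/t term is
   absent.  Finally x1 and H0 generate H1 for the shuffle product, so that Z^RB
   is the shuffle regularization. *)

Require Import Defs.
From HB Require Import structures.
From mathcomp Require Import all_boot all_order all_algebra finmap complex.
From mathcomp.multinomials Require Import monalg.
From mathcomp Require Import all_classical all_reals.
From mathcomp Require Import ereal topology normedtype sequences esum exp.
From mathcomp Require Import derive realfun.
From mathcomp Require Import ring lra.

Set Implicit Arguments.
Unset Strict Implicit.
Unset Printing Implicit Defensive.

Import Order.TTheory GRing.Theory Num.Theory numFieldNormedType.Exports.

Local Open Scope classical_set_scope.
Local Open Scope ring_scope.

(** * Coefficients of polylogarithms *)

Section Coefficients.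
Variable R : numFieldType.
Implicit Types (c d : nat -> R) (u v w : word).

Definition conv c d n : R := \sum_(i < n.+1) c i * d (n - i)%N.

(** On generating series this is multiplication by z/(1 - z) for [x1] and by 1 for [x0]. The sum
    over m < n is strict, like the inequalities n_1 > n_2 > ... between the indices. *)
Definition letter_op (l : letter) c n : R :=
  if l == x1 then \sum_(m < n) c m else c n.

(* [coeff w n] is the coefficient of z^n in Li_w(z) for [w] empty or ending
   in x1.  The inverse of 0 being 0, constant terms of nonempty words vanish. *)
Fixpoint coeff w n : R :=
  if w is l :: w' then letter_op l (coeff w') n / n%:R else (n == 0)%:R.

Lemma coeff_cons0 l w : coeff (l :: w) 0 = 0.
Proof. by rewrite /= invr0 mulr0. Qed.

Lemma letter_op_sum (I : Type) (s : seq I) l (F : I -> nat -> R) n :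
  letter_op l (fun m => \sum_(i <- s) F i m) n = \sum_(i <- s) letter_op l (F i) n.
Proof. by rewrite /letter_op; case: ifP => // _; rewrite exchange_big. Qed.

Lemma convC c d n : conv c d n = conv d c n.
Proof.
rewrite /conv (reindex_inj rev_ord_inj) /=; apply: eq_bigr => i _.
by rewrite mulrC subSS subKn // -ltnS.
Qed.

Lemma conv_delta c n : conv (fun m => (m == 0)%:R) c n = c n.
Proof.
rewrite /conv big_ord_recl /= subn0 mul1r big1 ?addr0 // => i _.
by rewrite mul0r.
Qed.

(** [letter_op] is multiplication by a fixed power series, so this is associativity of the Cauchy
    product. *)
Lemma conv_letter_op l c d n :
  conv (letter_op l c) d n = letter_op l (conv c d) n.
Proof.
rewrite /letter_op; case: ifP => // _.
elim: n => [|n IH]; first by rewrite /conv big_ord1 !big_ord0 mul0r.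
rewrite [RHS]big_ord_recr /= -IH /conv big_ord_recl big_ord0 mul0r add0r.
rewrite -big_split; apply: eq_bigr => i _ /=.
by rewrite big_ord_recr /= subSS mulrDl.
Qed.

(** The condition [last x1 w = x1] describes the words that are empty or end in [x1]. Here it
    excludes the word x0 alone, where the identity fails at n = 0 because the empty word has
    constant term 1. *)
Lemma coeffS l w n : last x1 (l :: w) = x1 ->
  n%:R * coeff (l :: w) n = letter_op l (coeff w) n.
Proof.
case: n => [|n] lw; last by rewrite mulrC divfK // pnatr_eq0.
rewrite mul0r /letter_op; case: ifP => [_|lx0]; first by rewrite big_ord0.
by case: w lw => [/= lx1|*]; [rewrite lx1 in lx0 | rewrite coeff_cons0].
Qed.

(* Euler's operator z d/dz is a derivation for the Cauchy product and maps the
   coefficients of Li_(a u) to [letter_op a] of those of Li_u, so that both sides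
   satisfy the recursion defining the shuffle product. *)
Lemma conv_coeff u v n : last x1 u = x1 -> last x1 v = x1 ->
  conv (coeff u) (coeff v) n = \sum_(w <- shuffle_word u v) coeff w n.
Proof.
elim: u v n => [|a u IHu] v n.
  by move=> _ _; rewrite conv_delta /= big_seq1.
move=> lu; elim: v n => [|b v IHv] n lv.
  by rewrite convC conv_delta /= big_seq1.
have lu' : last x1 u = x1 by case: (u) lu.
have lv' : last x1 v = x1 by case: (v) lv.
transitivity (\sum_(w <- shuffle_word u (b :: v)) coeff (a :: w) n +
              \sum_(w <- shuffle_word (a :: u) v) coeff (b :: w) n); last first.
  by rewrite -2!(big_map (cons _) predT (fun w => coeff w n)) -big_cat.
case: n => [|n].
  rewrite /conv big_ord1 coeff_cons0 mul0r.
  by rewrite !big1 ?addr0 // => w _; rewrite coeff_cons0.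
have n0 : n.+1%:R != 0 :> R by rewrite pnatr_eq0.
apply: (mulfI n0); rewrite mulrDr.
transitivity (conv (letter_op a (coeff u)) (coeff (b :: v)) n.+1 +
              conv (coeff (a :: u)) (letter_op b (coeff v)) n.+1).
  rewrite /conv -big_split mulr_sumr; apply: eq_bigr => i _.
  rewrite -(coeffS _ lu) -(coeffS _ lv).
  have -> : n.+1%:R = i%:R + (n.+1 - i)%:R :> R.
    by rewrite -natrD subnKC // -ltnS.
  move: (coeff _ _) (coeff _ _) => A B.
  by rewrite mulrDl !mulrA [B * _%:R]mulrC.
rewrite (convC (coeff (a :: u))) !conv_letter_op.
under [X in letter_op a X]funext do rewrite IHu //.
under [X in letter_op b X]funext do rewrite convC IHv //.
rewrite !letter_op_sum !mulr_sumr.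
by congr (_ + _); apply: eq_bigr => w _; rewrite /= [RHS]mulrC divfK.
Qed.

Lemma coeff_ge0 w n : 0 <= coeff w n.
Proof.
elim: w n => [|l w IH] n /=; first exact: ler0n.
apply: mulr_ge0; last by rewrite invr_ge0 ler0n.
by rewrite /letter_op; case: ifP => // _; apply: sumr_ge0.
Qed.

(** A sum of n coefficients that are at most 1 is divided by n. The bound gives radius of
    convergence 1 for all words. *)
Lemma coeff_le1 w n : coeff w n <= 1.
Proof.
elim: w n => [|l w IH] n /=; first by rewrite lern1 leq_b1.
case: n => [|n]; first by rewrite invr0 mulr0.
rewrite ler_pdivrMr ?ltr0Sn // mul1r /letter_op; case: ifP => _.
  apply: (@le_trans _ _ (\sum_(m < n.+1) 1)); first by apply: ler_sum.
  by rewrite sumr_const card_ord.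
by apply: (le_trans (IH _)); rewrite ler1n.
Qed.

End Coefficients.

(** * Words and the space H1 *)

Lemma shuffle_wordS a u b v : shuffle_word (a :: u) (b :: v) =
  map (cons a) (shuffle_word u (b :: v)) ++ map (cons b) (shuffle_word (a :: u) v).
Proof. by []. Qed.

Lemma size_shuffle_word u v w :
  w \in shuffle_word u v -> size w = (size u + size v)%N.
Proof.
elim: u v w => [|a u IHu] v w; first by rewrite inE => /eqP ->.
elim: v w => [|b v IHv] w; first by rewrite inE addn0 => /eqP ->.
rewrite shuffle_wordS mem_cat => /orP[] /mapP[q qr ->] /=.
  by rewrite (IHu _ _ qr).
by rewrite (IHv _ qr) /= addnS.
Qed.

Lemma last_shuffle u v w : last x1 u = x1 -> last x1 v = x1 ->
  w \in shuffle_word u v -> last x1 w = x1.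
Proof.
have lcons l t : last x1 (l :: t) = x1 -> last x1 t = x1 by case: t.
(* Prepending a letter to [s] keeps its last letter only if [s] is nonempty, which is read off the
   lengths below. *)
have lconsN l a t s : last x1 (l :: t) = x1 -> s != [::] ->
    last x1 s = x1 -> last x1 (a :: s) = x1 by case: s.
elim: u v w => [|a u IHu] v w; first by rewrite inE => _ lv /eqP ->.
move=> lu; elim: v w => [|b v IHv] w lv; first by rewrite inE => /eqP ->.
rewrite shuffle_wordS mem_cat => /orP[] /mapP[q qr ->].
  apply: (lconsN _ _ _ _ lu); last exact: IHu (lcons _ _ lu) lv qr.
  by move: (size_shuffle_word qr); case: (q) => //=; rewrite addnS.
apply: (lconsN _ _ _ _ lv); last exact: IHv (lcons _ _ lv) qr.
by move: (size_shuffle_word qr); case: (q).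
Qed.

Lemma word_of_comp_cons n s :
  word_of_comp (n :: s) = nseq n.-1 x0 ++ x1 :: word_of_comp s.
Proof. by rewrite /word_of_comp /= -cats1 -catA. Qed.

Lemma last_word_of_comp s : last x1 (word_of_comp s) = x1.
Proof.
by elim: s => [//|n s IH]; rewrite word_of_comp_cons last_cat.
Qed.

Lemma word_of_compP w : last x1 w = x1 ->
  exists2 s, composition s & w = word_of_comp s.
Proof.
elim: w => [|[] w IH] lw; first by exists [::].
  case: IH => [|s cs ->]; first by case: (w) lw.
  by exists (1%N :: s).
case: IH => [|[|n s] cs wE]; [by case: (w) lw | by rewrite wE in lw |].
exists (n.+1 :: s); first by case/andP: cs.
by rewrite wE !word_of_comp_cons; case: n cs {wE} => // n.
Qed.

(** Unlike the decomposition into blocks, the condition on the last letter passes directly to tails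
    and to shuffles. *)
Lemma H1P (f : Hsh) : H1 f <-> forall w, w \in msupp f -> last x1 w = x1.
Proof.
split=> [Hf w /Hf[s _ ->]|Hf w /Hf]; first exact: last_word_of_comp.
exact: word_of_compP.
Qed.

(** The default of [head] admits the empty word, and a first entry at least 2 amounts to a first
    letter x0. *)
Lemma H0P (f : Hsh) : H0 f <->
  forall w, w \in msupp f -> last x1 w = x1 /\ head x0 w = x0.
Proof.
split=> [Hf w /Hf[s [cs s2] ->]|Hf w /Hf[lw hw]].
  split; first exact: last_word_of_comp.
  case: s2 => [->//|]; case: s {cs} => //= n s.
  by rewrite word_of_comp_cons; case: n => [|[|n]].
case/word_of_compP: lw hw => s cs -> hs; exists s => //; split=> //.
case: s cs hs => [|n s]; [by left | right].
move: hs; rewrite word_of_comp_cons /=.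
by case: n cs => [|[|n]].
Qed.

Lemma H1U (a : rat) w : last x1 w = x1 -> H1 << a *g w >>.
Proof. by move=> lw; apply/H1P => v /(fsubsetP msuppU_le); rewrite inE => /eqP ->. Qed.

Lemma H0U (a : rat) w : last x1 w = x1 -> head x0 w = x0 -> H0 << a *g w >>.
Proof. by move=> lw hw; apply/H0P => v /(fsubsetP msuppU_le); rewrite inE => /eqP ->. Qed.

Lemma monalgU_scale (a : rat) w : << a *g w >> = a *: << w >> :> Hsh.
Proof. by apply/malgP => v; rewrite mcoeffZ !mcoeffU mulrnAr mulr1. Qed.

Lemma monalg_sumZ (f : Hsh) : f = \sum_(w <- msupp f) f@_w *: << w >>.
Proof. by rewrite {1}[f]monalgE; apply: eq_bigr => w _; exact: monalgU_scale. Qed.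

Lemma H10 : H1 0.
Proof. by apply/H1P => w; rewrite msupp0. Qed.

Lemma H1D f g : H1 f -> H1 g -> H1 (f + g).
Proof.
move=> /H1P Hf /H1P Hg; apply/H1P => w /(fsubsetP (msuppD_le f g)).
by rewrite inE => /orP[/Hf|/Hg].
Qed.

Lemma H1Z a f : H1 f -> H1 (a *: f).
Proof. by move=> /H1P Hf; apply/H1P => w /(fsubsetP (msuppZ_le a f))/Hf. Qed.

Lemma H1_sum (I : eqType) (s : seq I) (F : I -> Hsh) :
  (forall i, i \in s -> H1 (F i)) -> H1 (\sum_(i <- s) F i).
Proof.
move=> HF; rewrite big_seq; elim/big_ind : _ => //; [exact: H10 | exact: H1D].
Qed.

Lemma shuffleU (a b : rat) u v : shuffle << a *g u >> << b *g v >> =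
  \sum_(w <- shuffle_word u v) << a * b *g w >>.
Proof.
rewrite /shuffle !msuppU.
(* A zero coefficient leaves an empty support and is treated apart. *)
case: (eqVneq a 0) => [->|a0].
  by rewrite big_seq_fset0 big1 // => w _; rewrite mul0r monalgU0.
case: (eqVneq b 0) => [->|b0]; rewrite big_seq_fset1.
  by rewrite big_seq_fset0 big1 // => w _; rewrite mulr0 monalgU0.
by rewrite big_seq_fset1; apply: eq_bigr => w _; rewrite !mcoeffUU.
Qed.

(** * Uniqueness of the shuffle regularization on H1 *)

Section Uniqueness.
Variables (R : realType) (Z Z' : Hsh -> {poly R}).
Hypotheses (HZ : shuffle_regularization Z) (HZ' : shuffle_regularization Z').

Lemma regularization_sum (Y : Hsh -> {poly R}) (I : eqType) (s : seq I)
    (a : I -> rat) (F : I -> Hsh) : shuffle_regularization Y ->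
  (forall i, i \in s -> H1 (F i)) ->
  Y (\sum_(i <- s) a i *: F i) = \sum_(i <- s) ratr (a i) *: Y (F i).
Proof.
move=> [YD _ _ _ _]; elim: s => [|i s IH] HF.
  (* Linearity with factor -1 gives Y 0 = - Y 0 + Y 0 = 0. *)
  rewrite !big_nil; have := YD (-1) 0 0 H10 H10.
  by rewrite scaleN1r oppr0 addr0 rmorphN1 scaleN1r addNr.
have Fs j : j \in s -> H1 (F j) by move=> js; apply: HF; rewrite inE js orbT.
rewrite !big_cons YD ?IH //; first by apply: HF; rewrite mem_head.
by apply: H1_sum => j /Fs; apply: H1Z.
Qed.

Lemma regularization_sumU (Y : Hsh -> {poly R}) (s : seq word) :
  shuffle_regularization Y -> (forall w, w \in s -> last x1 w = x1) ->
  Y (\sum_(w <- s) << w >>) = \sum_(w <- s) Y << w >>.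
Proof.
move=> HY Hs; have := @regularization_sum Y _ s (fun=> 1) (fun w => << w >>) HY.
under eq_bigr do rewrite scale1r; move=> ->; last by move=> w /Hs; apply: H1U.
by apply: eq_bigr => w _; rewrite rmorph1 scale1r.
Qed.

(** Before the displayed x0 the new letter has k+1 places, all giving the same word; otherwise it is
    shuffled into [u]. *)
Lemma shuffle_x1_nseq k u :
  shuffle_word [:: x1] (nseq k x1 ++ x0 :: u) =
    nseq k.+1 (nseq k.+1 x1 ++ x0 :: u) ++
    [seq nseq k x1 ++ x0 :: t | t <- shuffle_word [:: x1] u].
Proof.
elim: k => [//|k IH].
rewrite [nseq k.+1 x1 ++ _]/= shuffle_wordS {}IH /= map_cat map_nseq -map_comp.
by congr (_ :: _ :: _ ++ _).
Qed.

Lemma shuffle_x1_nseq0 k :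
  shuffle_word [:: x1] (nseq k x1) = nseq k.+1 (nseq k.+1 x1).
Proof.
elim: k => [//|k IH].
by rewrite [nseq k.+1 x1]/= shuffle_wordS IH map_nseq.
Qed.

(* Shuffling x1 with x1^k x0 u gives k+1 times x1^(k+1) x0 u plus words with
   only k leading letters x1. *)
Lemma regularization_unique_word w : last x1 w = x1 -> Z << w >> = Z' << w >>.
Proof.
move=> lw; have [k [v [-> hv lv]]] : exists k v,
    [/\ w = nseq k x1 ++ v, head x0 v = x0 & last x1 v = x1].
  elim: w lw => [|[] w IH] lw; first by exists 0%N, [::].
    case: IH => [|k [v [-> hv lv]]]; first by case: (w) lw.
    by exists k.+1, v.
  by exists 0%N, (x0 :: w).
(* The product rule for x1 and w' is solved for the value at x1 w', whose multiplicity k'+1 is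
   invertible. *)
have unq0 (Y : Hsh -> {poly R}) k' s w' : shuffle_regularization Y ->
    H1 << w' >> -> last x1 w' = x1 -> 
    shuffle_word [:: x1] w' = nseq k'.+1 (x1 :: w') ++ s ->
    (forall t, t \in s -> last x1 t = x1) ->
    Y << x1 :: w' >> = k'.+1%:R^-1 *: ('X * Y << w' >> - \sum_(t <- s) Y << t >>).
  move=> HY Hw' lw' shE Hs; have [_ _ YM _ YX] := HY.
  have := YM << [:: x1] >> << w' >>; rewrite YX => <- //; last exact: H1U.
  rewrite shuffleU mulr1 regularization_sumU //; last by move=> t /last_shuffle; apply.
  rewrite shE big_cat /= addrK big_cons big_nseq -iterS.
  by rewrite iter_addr_0 -scalerMnr scalerMnl -mulr_natr mulVf ?pnatr_eq0 // scale1r.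
have lnv m : last x1 (nseq m x1 ++ v) = x1.
  rewrite last_cat; suff -> : last x1 (nseq m x1) = x1 by [].
  by elim: m => // m; case: m.
have [_ _ _ Z0 _] := HZ; have [_ _ _ Z0' _] := HZ'.
elim: k v hv lv lnv {lw w} => [|k IH] v hv lv lnv.
  by rewrite Z0 ?Z0' //; apply: H0U.
(* The remaining words [s] consist of [k] letters x1 followed by some [v'] of the same kind as [v],
   so the induction on [k], with [v] arbitrary, covers them. *)
have [s shE [Hs sE]] : exists2 s,
    shuffle_word [:: x1] (nseq k x1 ++ v) = nseq k.+1 (nseq k.+1 x1 ++ v) ++ s &
    (forall t, t \in s -> last x1 t = x1) /\
    forall t, t \in s -> exists2 v', t = nseq k x1 ++ v' & head x0 v' = x0 /\ last x1 v' = x1.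
  case: v hv lv lnv => [|[] u] // hv lv lnv.
    by exists [::] => //; rewrite !cats0 shuffle_x1_nseq0.
  exists [seq nseq k x1 ++ x0 :: t | t <- shuffle_word [:: x1] u].
    exact: shuffle_x1_nseq.
  have lt t : t \in shuffle_word [:: x1] u -> last x1 (x0 :: t) = x1.
    have lu : last x1 u = x1 by move: lv; case: (u).
    move=> tu; have := last_shuffle (erefl : last x1 [:: x1] = x1) lu tu.
    by case: t tu => // /size_shuffle_word.
  split=> t /mapP[r ru ->]; first by rewrite last_cat; exact: lt.
  by exists (x0 :: r) => //; split=> //; apply: lt.
have Hk : H1 << nseq k x1 ++ v >> := H1U (lnv k).
rewrite [nseq k.+1 x1 ++ v]/= (unq0 Z k s) ?(unq0 Z' k s) //.
congr (_ *: (_ * _ - _)); first exact: IH.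
rewrite big_seq [RHS]big_seq; apply: eq_bigr => t ts.
have [v' -> [hv' lv']] := sE _ ts.
apply: IH => // m; rewrite last_cat; suff -> : last x1 (nseq m x1) = x1 by [].
by elim: m => // m; case: m.
Qed.

Lemma regularization_unique f : H1 f -> Z f = Z' f.
Proof.
move=> /H1P Hf; rewrite (monalg_sumZ f).
rewrite !regularization_sum // => [|w /Hf lw|w /Hf lw]; try exact: H1U.
rewrite big_seq [RHS]big_seq; apply: eq_bigr => w /Hf lw.
by rewrite regularization_unique_word.
Qed.

End Uniqueness.

(** * Real power series *)

Section PowerSeries.
Variable R : realType.
Implicit Types (c d : nat -> R) (x q r rho : R).

(** Each of the n terms of 1 + q + ... + q^(n-1) is at least q^n, and (1 - q) times this sum is 1 -
    q^n <= 1. *)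
Lemma natr_geometric_bounded q n : 0 <= q -> q < 1 ->
  n%:R * q ^+ n <= (1 - q)^-1.
Proof.
move=> q0 q1; have d0 : 0 < 1 - q by rewrite subr_gt0.
rewrite -[leRHS]mul1r ler_pdivlMr // mulrC.
apply: (@le_trans _ _ (1 - q ^+ n)); last by rewrite gerBl exprn_ge0.
rewrite -[1 - q ^+ n]opprB subrX1 -mulNr opprB ler_pM2l // mulr_natl -[n in X in X <= _]card_ord.
rewrite -sumr_const; apply: ler_sum => i _.
by rewrite card_ord ler_wiXn2l ?(ltW q1) // ltnW.
Qed.

(** Boundedness of the terms at every r < rho says that the radius of convergence is at least rho,
    in a form easy to transport along algebraic operations. *)
Definition has_radius rho c := forall r, 0 <= r -> r < rho ->
  exists M, forall n, `|c n| * r ^+ n <= M.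

Definition psum c x : R := limn (pseries c x).

(** Boundedness at some s between r and rho gives geometric decay at r with ratio q = r/s. The ratio
    does not depend on [c], so one q serves both factors of a Cauchy product. *)
Lemma radius_geometric rho r : 0 <= r -> r < rho ->
  exists2 q, 0 <= q < 1 & forall c, has_radius rho c ->
    exists2 M, 0 <= M & forall n, `|c n| * r ^+ n <= M * q ^+ n.
Proof.
move=> r0 rrho; have [s rs srho] : exists2 s, r < s & s < rho.
  by exists ((r + rho) / 2); lra.
have s0 : 0 < s by apply: le_lt_trans rs.
exists (r / s) => [|c rc].
  by rewrite divr_ge0 ?(ltW s0) // ltr_pdivrMr // mul1r.
have [M HM] := rc _ (ltW s0) srho; exists M => [|n].
  by have := HM 0%N; rewrite expr0 mulr1; apply: le_trans.
rewrite expr_div_n mulrA ler_pdivlMr ?exprn_gt0 //.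
by rewrite mulrAC ler_wpM2r // exprn_ge0.
Qed.

Lemma is_cvg_pseries rho c x : has_radius rho c -> `|x| < rho -> cvgn (pseries c x).
Proof.
move=> rc xrho; have [q /andP[q0 q1] /(_ _ rc)[M M0 Hq]] := radius_geometric (normr_ge0 x) xrho.
apply: normed_cvg; apply: (@series_le_cvg _ _ (geometric M q)) => /=.
- by move=> n.
- by move=> n; rewrite mulr_ge0 // exprn_ge0.
- by move=> n; rewrite normrM normrX.
- by apply: is_cvg_geometric_series; rewrite ger0_norm.
Qed.

Lemma psumD rho c d x : has_radius rho c -> has_radius rho d -> `|x| < rho ->
  psum (fun n => c n + d n) x = psum c x + psum d x.
Proof.
move=> rc rd xr; rewrite /psum /pseries -lim_seriesD; last 2 first.
- exact: is_cvg_pseries rc xr.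
- exact: is_cvg_pseries rd xr.
by congr (limn (series _)); apply/funext => n /=; rewrite mulrDl.
Qed.

Lemma psumZ rho a c x : has_radius rho c -> `|x| < rho ->
  psum (fun n => a * c n) x = a * psum c x.
Proof.
move=> rc xr; rewrite /psum /pseries -[RHS]lim_seriesZ; last first.
  exact: is_cvg_pseries rc xr.
by congr (limn (series _)); apply/funext => n /=; rewrite -mulrA.
Qed.

Lemma radius_le rho c (d : nat -> R) (k : R) :
  (forall n, `|d n| <= k * `|c n|) -> has_radius rho c -> has_radius rho d.
Proof.
move=> dc rc r r0 rrho; have [M HM] := rc r r0 rrho.
have k0 n : c n != 0 -> 0 <= k.
  move=> cn0; rewrite -(pmulr_lge0 k (_ : 0 < `|c n|)) ?normr_gt0 //.
  exact: le_trans (dc n).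
exists (`|k| * M) => n; apply: (@le_trans _ _ (k * `|c n| * r ^+ n)).
  by rewrite ler_wpM2r // exprn_ge0.
rewrite -mulrA; apply: (@le_trans _ _ (`|k| * (`|c n| * r ^+ n))).
  by rewrite ler_wpM2r ?ler_norm // mulr_ge0 // exprn_ge0.
by rewrite ler_wpM2l.
Qed.

Lemma radiusD rho c d : has_radius rho c -> has_radius rho d ->
  has_radius rho (fun n => c n + d n).
Proof.
move=> rc rd r r0 rrho; have [M HM] := rc r r0 rrho; have [N HN] := rd r r0 rrho.
exists (M + N) => n; apply: (@le_trans _ _ ((`|c n| + `|d n|) * r ^+ n)).
  by rewrite ler_wpM2r ?ler_normD // exprn_ge0.
by rewrite mulrDl lerD.
Qed.

Lemma radiusZ rho a c : has_radius rho c -> has_radius rho (fun n => a * c n).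
Proof. by apply: (@radius_le _ _ _ `|a|) => n; rewrite normrM. Qed.

Lemma bounded_radius1 c (k : R) : (forall n, `|c n| <= k) -> has_radius 1 c.
Proof.
move=> ck r r0 r1; exists k => n; apply: le_trans (ck n).
by rewrite ler_piMr // exprn_ile1 // ltW.
Qed.

Lemma radius_delta rho m (a : R) : has_radius rho (fun n => if n == m then a else 0).
Proof.
move=> r r0 _; exists (`|a| * r ^+ m) => n; case: eqP => [->//|_].
by rewrite normr0 mul0r mulr_ge0 // exprn_ge0.
Qed.

Lemma radius_shift rho c : has_radius rho c -> has_radius rho (fun n => c n.+1).
Proof.
(* The shift divides by the radius, which may be 0; a larger s > 0 takes its place. *)
move=> rc r r0 rrho; have [s rs srho] : exists2 s, r < s & s < rho.
  by exists ((r + rho) / 2); lra.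
have s0 : 0 < s by apply: le_lt_trans rs.
have [M HM] := rc _ (ltW s0) srho.
exists (M / s) => n; rewrite ler_pdivlMr //.
apply: le_trans (HM n.+1); rewrite -mulrA ler_wpM2l // exprSr ler_wpM2r ?(ltW s0) //.
by apply: lerXn2r; rewrite ?nnegrE // ltW.
Qed.

Lemma psum_shift rho c x : has_radius rho c -> `|x| < rho ->
  psum c x = c 0%N + x * psum (fun n => c n.+1) x.
Proof.
move=> rc xr; have cS := is_cvg_pseries (radius_shift rc) xr.
apply: cvg_lim => //; rewrite -(cvg_shiftS (pseries c x)).
rewrite [X in X @ \oo --> _](_ : _ =
    (fun n => c 0%N + x * pseries (fun n => c n.+1) x n)).
  by apply: cvgD; [exact: cvg_cst | apply: cvgM => //; exact: cvg_cst].
apply/funext => n; rewrite /pseries /series /= big_nat_recl // expr0 mulr1.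
by congr (_ + _); rewrite mulr_sumr; apply: eq_bigr => i _; rewrite exprS mulrCA.
Qed.

Lemma radius_primitive rho c : has_radius rho c -> has_radius rho (fun n => c n / n%:R).
Proof.
apply: (@radius_le _ _ _ 1) => n; rewrite mul1r normrM ler_piMr //.
case: n => [|n]; first by rewrite invr0 normr0.
by rewrite normfV ger0_norm // invf_le1 ?ltr0Sn // ler1n.
Qed.

Lemma radius_diffs rho c : has_radius rho c -> has_radius rho (pseries_diffs c).
Proof.
move=> rc r r0 rrho.
have [q /andP[q0 q1] /(_ _ (radius_shift rc))[M M0 Hq]] :=
  radius_geometric r0 rrho.
exists (M * ((1 - q)^-1 + 1)) => n; rewrite /pseries_diffs normrM normr_nat.
apply: (@le_trans _ _ (n.+1%:R * (M * q ^+ n))).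
  by rewrite -mulrA ler_wpM2l.
rewrite mulrCA ler_wpM2l // -natr1 mulrDl mul1r lerD //.
  exact: natr_geometric_bounded.
by rewrite exprn_ile1 // ltW.
Qed.

Lemma is_derive_psum rho c x : has_radius rho c -> `|x| < rho ->
  is_derive x 1 (psum c) (psum (pseries_diffs c) x).
Proof.
move=> rc xrho; have [K xK Krho] : exists2 K, `|x| < K & K < rho.
  by exists ((`|x| + rho) / 2); lra.
have K0 : `|K| = K by rewrite ger0_norm // (le_trans _ (ltW xK)).
apply: (@pseries_snd_diffs _ c K); rewrite ?K0 //.
- by apply: (@is_cvg_pseries rho); rewrite ?K0.
- by apply: (@is_cvg_pseries rho); rewrite ?K0 //; apply: radius_diffs.
- by apply: (@is_cvg_pseries rho); rewrite ?K0 //; do 2!apply: radius_diffs.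
Qed.

Lemma psum_bounded rho c r : has_radius rho c -> 0 <= r -> r < rho ->
  exists M, forall x, `|x| <= r -> `|psum c x| <= M.
Proof.
move=> rc r0 rrho; have [q /andP[q0 q1] /(_ _ rc)[M M0 Hq]] := radius_geometric r0 rrho.
have cvg_geo : cvgn (series (geometric M q)).
  by apply: is_cvg_geometric_series; rewrite ger0_norm.
exists (limn (series (geometric M q))) => x xr.
have le n : `|c n * x ^+ n| <= geometric M q n.
  rewrite normrM normrX; apply: le_trans (Hq n).
  by rewrite ler_wpM2l //; apply: lerXn2r; rewrite ?nnegrE.
have cvgN : cvgn [normed pseries c x].
  apply: (@series_le_cvg _ _ (geometric M q)) => // n.
    exact: normr_ge0.
  by rewrite /= mulr_ge0 // exprn_ge0.
apply: le_trans (lim_series_norm cvgN) _.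
exact: lim_series_le.
Qed.

Lemma conv_term_le c d (M N q r : R) n : 0 <= r ->
  (forall m, `|c m| * r ^+ m <= M * q ^+ m) ->
  (forall m, `|d m| * r ^+ m <= N * q ^+ m) ->
  \sum_(i < n.+1) `|c i * d (n - i)%N| * r ^+ n <= n.+1%:R * (M * N * q ^+ n).
Proof.
move=> r0 Hc Hd; rewrite mulr_natl -[n.+1 in leRHS]card_ord -sumr_const.
apply: ler_sum => i _; rewrite normrM.
have iE : n = (i + (n - i))%N by rewrite subnKC // -ltnS.
have -> : r ^+ n = r ^+ i * r ^+ (n - i) by rewrite -exprD -iE.
have -> : q ^+ n = q ^+ i * q ^+ (n - i) by rewrite -exprD -iE.
rewrite mulrACA [leRHS]mulrACA.
by apply: ler_pM => //; rewrite mulr_ge0 // exprn_ge0.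
Qed.

Lemma radius_conv rho c d : has_radius rho c -> has_radius rho d -> has_radius rho (conv c d).
Proof.
move=> rc rd r r0 rrho; have [q /andP[q0 q1] Hq] := radius_geometric r0 rrho.
have [M M0 Hc] := Hq _ rc; have [N N0 Hd] := Hq _ rd.
exists (M * N * ((1 - q)^-1 + 1)) => n.
apply: (@le_trans _ _ (n.+1%:R * (M * N * q ^+ n))).
  apply: le_trans (conv_term_le n r0 Hc Hd); rewrite -mulr_suml.
  by rewrite ler_wpM2r ?exprn_ge0 // ler_norm_sum.
rewrite mulrCA ler_wpM2l ?mulr_ge0 // -natr1 mulrDl mul1r lerD //.
  exact: natr_geometric_bounded.
by rewrite exprn_ile1 // ltW.
Qed.

Lemma cvg_sqr_geometric q : 0 <= q -> q < 1 ->
  (fun n => n%:R ^+ 2 * q ^+ n) @ \oo --> (0 : R).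
Proof.
(* With t the fourth root of q, n^2 q^n = (n t^n)^2 (t^2)^n, and n t^n is bounded. *)
move=> q0 q1; pose t := Num.sqrt (Num.sqrt q).
have t0 : 0 <= t by exact: sqrtr_ge0.
have qE : q = t ^+ 2 * t ^+ 2 by rewrite sqr_sqrtr ?sqrtr_ge0 // -expr2 sqr_sqrtr.
have t1 : t < 1.
  rewrite ltNge; apply/negP => t1; move: q1; rewrite ltNge qE => /negP; apply.
  by rewrite -expr2 !exprn_ege1.
have [K0 KH] : 0 <= (1 - t)^-1 /\ forall n, n%:R * t ^+ n <= (1 - t)^-1.
  split=> [|n]; last exact: natr_geometric_bounded.
  by rewrite invr_ge0 subr_ge0 ltW.
apply: (@squeeze_cvgr _ _ _ _ (fun=> 0) (geometric ((1 - t)^-1 ^+ 2) (t ^+ 2))).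
- apply: nearW => n; rewrite mulr_ge0 ?exprn_ge0 //= qE exprMn mulrA.
  rewrite [(t ^+ 2) ^+ n]exprAC -exprMn ler_wpM2r ?exprn_ge0 //.
  by apply: lerXn2r; rewrite ?nnegrE ?mulr_ge0 ?exprn_ge0.
- exact: cvg_cst.
- by apply: cvg_geometric; rewrite ger0_norm ?exprn_ge0 // exprn_ilt1.
Qed.

(* The product of the partial sums of order N is a polynomial of degree less
   than 2N whose coefficients agree with those of the Cauchy product below N. *)
Lemma psum_conv rho c d x : has_radius rho c -> has_radius rho d -> `|x| < rho ->
  psum (conv c d) x = psum c x * psum d x.
Proof.
move=> rc rd xr; have [q /andP[q0 q1] Hq] := radius_geometric (normr_ge0 x) xr.
have [M M0 Hc] := Hq _ rc; have [N N0 Hd] := Hq _ rd.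
have cvgc : cvgn (pseries c x) by apply: is_cvg_pseries xr.
have cvgd : cvgn (pseries d x) by apply: is_cvg_pseries xr.
pose cd n := pseries c x n * pseries d x n.
have cvgcd : cd @ \oo --> psum c x * psum d x by apply: cvgM.
have bound n : `|cd n - pseries (conv c d) x n| <=
    M * N * 2 * (n%:R ^+ 2 * q ^+ n).
  pose P := \poly_(i < n) c i; pose Q := \poly_(i < n) d i.
  have serE (f : nat -> R) : pseries f x n = (\poly_(i < n) f i).[x].
    by rewrite horner_poly /pseries /series /= big_mkord.
  have PQE (i : nat) : (P * Q)`_i = conv (fun j => P`_j) (fun j => Q`_j) i.
    by rewrite coefM.
  have coefE i : (i < n)%N -> (P * Q)`_i = conv c d i.
    move=> ilt; rewrite PQE; apply: eq_bigr => j _; rewrite !coef_poly.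
    have jn : (j < n)%N by apply: leq_ltn_trans ilt; rewrite -ltnS.
    by rewrite jn (leq_ltn_trans (leq_subr _ _) ilt).
  have -> : cd n - pseries (conv c d) x n = \sum_(n <= i < n + n) (P * Q)`_i * x ^+ i.
    rewrite /cd !serE -hornerM (@horner_coef_wide _ (n + n)); last first.
      apply: leq_trans (size_polyMleq _ _) _; apply: leq_trans (leq_pred _) _.
      by rewrite leq_add // size_poly.
    rewrite -(big_mkord xpredT (fun i => (P * Q)`_i * x ^+ i)).
    rewrite (@big_cat_nat _ _ _ n) ?leq_addr //= horner_poly big_mkord.
    rewrite addrAC -sumrB big1 ?add0r // => i _.
    by rewrite coefE // subrr.
  have trunc (f : nat -> R) K : 0 <= K ->
      (forall m, `|f m| * `|x| ^+ m <= K * q ^+ m) ->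
      forall m, `|(\poly_(i < n) f i)`_m| * `|x| ^+ m <= K * q ^+ m.
    move=> K0 Hf m; rewrite coef_poly; case: ifP => // _.
    by rewrite normr0 mul0r mulr_ge0 // exprn_ge0.
  apply: le_trans (ler_norm_sum _ _ _) _.
  (* For n <= i < 2n one has i + 1 <= 2n and q^i <= q^n; there are n such terms. *)
  apply: (@le_trans _ _ (\sum_(n <= i < n + n) M * N * 2 * (n%:R * q ^+ n))).
    rewrite big_nat [leRHS]big_nat; apply: ler_sum => i /andP[ni in2].
    rewrite normrM normrX PQE.
    apply: (@le_trans _ _ (i.+1%:R * (M * N * q ^+ i))).
      apply: le_trans (conv_term_le i (normr_ge0 x) (trunc _ _ M0 Hc) (trunc _ _ N0 Hd)).
      by rewrite -mulr_suml ler_wpM2r ?exprn_ge0 // ler_norm_sum.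
    rewrite mulrCA -!mulrA ler_wpM2l // ler_wpM2l // mulrA.
    rewrite ler_pM ?exprn_ge0 //; last by rewrite ler_wiXn2l // ltW.
    by rewrite -natrM ler_nat mul2n -addnn.
  rewrite sumr_const_nat addnK -mulrnAr -[_ *+ n]mulr_natl expr2.
  by rewrite [_ * (_ * q ^+ n)]mulrA.
apply: cvg_lim => //; rewrite -[psum c x * _](subr0).
rewrite [X in X @ \oo --> _](_ : _ = cd - (fun n => cd n - pseries (conv c d) x n)).
  apply: cvgB => //.
  apply: (@squeeze_cvgr _ _ _ _ (fun n => - (M * N * 2 * (n%:R ^+ 2 * q ^+ n)))
      (fun n => M * N * 2 * (n%:R ^+ 2 * q ^+ n))).
  - by apply: nearW => n; rewrite -ler_norml.
  - rewrite -oppr0 -(mulr0 (M * N * 2)); apply: cvgN.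
    by apply: cvgM; [exact: cvg_cst | exact: cvg_sqr_geometric].
  - by rewrite -(mulr0 (M * N * 2)); apply: cvgM; [exact: cvg_cst | exact: cvg_sqr_geometric].
by apply/funext => n /=; rewrite opprB addrCA subrr addr0.
Qed.

End PowerSeries.

(** * Expansions in powers of the logarithm *)

Section LogSeries.
Variable R : realType.
Implicit Types (b : nat -> R) (c : nat -> nat -> R) (h g : R -> R) (P Q : {poly R}).

Definition nlog (x : R) : R := - ln (- x).

(* Stating the expansion for all large orders [N] makes sums immediate. *)
Definition log_series rho h P := exists c m, (forall j, has_radius rho (c j)) /\
  forall N, (m <= N)%N ->
    (forall x, - rho < x -> x < 0 ->
       h x = \sum_(j < N) psum (c j) x * nlog x ^+ j) /\
    P = \poly_(j < N) c j 0%N.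

Lemma norm_lt_radius (x rho : R) : - rho < x -> x < 0 -> `|x| < rho.
Proof. by move=> xr x0; rewrite ltr0_norm // ltrNl. Qed.

Lemma log_series_ext rho h g P : (forall x, - rho < x -> x < 0 -> g x = h x) ->
  log_series rho h P -> log_series rho g P.
Proof.
move=> gh [c [m [rc H]]]; exists c, m; split => // N /H[hE PE]; split => // x xr x0.
by rewrite gh // hE.
Qed.

Lemma log_seriesD rho h g P Q : log_series rho h P -> log_series rho g Q ->
  log_series rho (fun x => h x + g x) (P + Q).
Proof.
move=> [c [m [rc H]]] [d [n [rd G]]].
exists (fun j k => c j k + d j k), (maxn m n); split=> [j|N]; first exact: radiusD.
rewrite geq_max => /andP[/H[hE PE] /G[gE QE]]; split => [x xr x0|].
  rewrite hE // gE // -big_split; apply: eq_bigr => j _ /=.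
  by rewrite (psumD (rc j) (rd j)) ?norm_lt_radius // mulrDl.
rewrite PE QE; apply/polyP => i; rewrite coefD !coef_poly.
by case: ifP => // _; rewrite addr0.
Qed.

Lemma log_series_mul rho b h P : has_radius rho b -> log_series rho h P ->
  log_series rho (fun x => psum b x * h x) (b 0%N *: P).
Proof.
move=> rb [c [m [rc H]]]; exists (fun j => conv b (c j)), m.
split=> [j|N /H[hE PE]]; first exact: radius_conv.
split=> [x xr x0|].
  rewrite hE // mulr_sumr; apply: eq_bigr => j _.
  by rewrite (psum_conv rb (rc j)) ?norm_lt_radius // mulrA.
rewrite PE; apply/polyP => i; rewrite coefZ !coef_poly.
by case: ifP => _; rewrite ?mulr0 // /conv big_ord1.
Qed.

Lemma psum_delta0 (a x : R) : psum (fun n => if n == 0%N then a else 0) x = a.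
Proof.
apply: lim_near_cst => //; exists 1%N => // n /= n0.
rewrite /pseries /series /= big_mkord; case: n n0 => // n _.
by rewrite big_ord_recl /= expr0 mulr1 big1 ?addr0 // => i _; rewrite mul0r.
Qed.

Lemma psum_delta1 (a x : R) : psum (fun n => if n == 1%N then a else 0) x = a * x.
Proof.
apply: lim_near_cst => //; exists 2%N => // n /= n0.
rewrite /pseries /series /= big_mkord; case: n n0 => [|[|n]] // _.
by rewrite !big_ord_recl /= mul0r add0r expr1 big1 ?addr0 // => i _; rewrite mul0r.
Qed.

Lemma log_seriesZ rho (a : R) h P : log_series rho h P ->
  log_series rho (fun x => a * h x) (a *: P).
Proof.
move/(log_series_mul (@radius_delta _ rho 0 a)).
by apply: log_series_ext => x _ _; rewrite psum_delta0.
Qed.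

Lemma log_series_monomial rho b k : has_radius rho b ->
  log_series rho (fun x => psum b x * nlog x ^+ k) (b 0%N *: 'X^k).
Proof.
move=> rb; exists (fun j n => if j == k then b n else 0), k.+1.
split=> [j|N kN].
  by case: (j == k) => // r _ _; exists 0 => n; rewrite normr0 mul0r.
split=> [x xr x0|].
  rewrite (bigD1 (Ordinal kN)) //= eqxx big1 ?addr0 // => j.
  rewrite -(inj_eq val_inj) /= => /negbTE ->; rewrite (_ : psum _ _ = 0) ?mul0r //.
  apply: lim_near_cst => //; apply: nearW => n.
  by rewrite /pseries /series /= big1 // => i _; rewrite mul0r.
apply/polyP => i; rewrite coefZ coef_poly coefXn.
case: eqP => [->|]; first by rewrite kN mulr1.
by rewrite mulr0; case: ifP.
Qed.

Lemma log_series_cst rho (a : R) : log_series rho (fun=> a) a%:P.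
Proof.
have := log_series_monomial 0 (@radius_delta _ rho 0 a).
rewrite /= expr0 alg_polyC; apply: log_series_ext => x _ _.
by rewrite psum_delta0 expr0 mulr1.
Qed.

Lemma log_series_sum rho (I : eqType) (s : seq I) (h : I -> R -> R) (P : I -> {poly R}) :
  (forall i, i \in s -> log_series rho (h i) (P i)) ->
  log_series rho (fun x => \sum_(i <- s) h i x) (\sum_(i <- s) P i).
Proof.
elim: s => [_|i s IH H].
  rewrite big_nil; apply: log_series_ext (log_series_cst rho 0) => x _ _.
  by rewrite big_nil.
have Hs j : j \in s -> log_series rho (h j) (P j).
  by move=> js; apply: H; rewrite inE js orbT.
rewrite big_cons; apply: log_series_ext (log_seriesD (H i (mem_head i s)) (IH Hs)).
by move=> x _ _; rewrite big_cons.
Qed.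

Lemma is_derive_nlog (x : R) : x < 0 -> is_derive x 1 nlog (- x^-1).
Proof.
move=> x0; have nx : 0 < - x by rewrite oppr_gt0.
have D := is_derive1_comp (is_derive1_ln nx) (is_deriveN (is_derive_id x (1 : R))).
by apply: is_derive_eq (is_deriveN D) _; rewrite invrN mulrN1 opprK.
Qed.

Lemma psum_primitive rho b (x : R) : has_radius rho b -> - rho < x -> x < 0 ->
  psum (pseries_diffs (fun n => b n / n%:R)) x = x^-1 * (psum b x - b 0%N).
Proof.
move=> rb xr x0; rewrite (psum_shift rb) ?norm_lt_radius // addrC addKr.
rewrite mulKf ?lt_eqF //; congr psum; apply/funext => n.
by rewrite /pseries_diffs mulrC divfK // pnatr_eq0.
Qed.

(* Integration by parts: with C' = (b - b_0)/x, a primitive of b/x * L^j is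
   C L^j - b_0 L^(j+1)/(j+1) plus j times a primitive of C/x * L^(j-1). *)
Lemma log_series_primitive_monomial rho b k : has_radius rho b ->
  exists g Q, [/\ log_series rho g Q,
    forall x, - rho < x -> x < 0 ->
      is_derive x 1 g (x^-1 * (psum b x * nlog x ^+ k)) &
    b 0%N = 0 -> Q = 0].
Proof.
elim: k b => [|k IH] b rb.
all: pose C := (fun n => b n / n%:R); have rC := radius_primitive rb : has_radius rho C.
(* The inverse of 0 is 0, so the constant of integration is such that [C] vanishes at 0. *)
all: have C0 : C 0%N = 0 by rewrite /C invr0 mulr0.
  exists (fun x => psum C x * nlog x ^+ 0 + - b 0%N * nlog x).
  exists (C 0%N *: 'X^0 + - b 0%N *: 'X^1); split.
  - apply: log_seriesD; first exact: log_series_monomial.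
    have := log_series_monomial 1 (@radius_delta _ rho 0 (- b 0%N)).
    by apply: log_series_ext => x _ _; rewrite psum_delta0 expr1.
  - move=> x xr x0.
    have D := is_deriveD (is_derive_psum rC (norm_lt_radius xr x0))
      (is_deriveZ (- b 0%N) (is_derive_nlog x0)).
    rewrite [X in is_derive _ _ X _](_ : _ = psum C + (- b 0%N) \*: nlog).
      apply: is_derive_eq D _; rewrite (psum_primitive rb xr x0) expr0 mulr1 /GRing.scale /=.
      by rewrite mulrBr mulrNN [b 0%N * _]mulrC subrK.
    by apply/funext => y; rewrite expr0 mulr1.
  - by move=> b0; rewrite C0 b0 oppr0 !scale0r addr0.
(* As [C] vanishes at 0, the recursive primitive contributes nothing to the polynomial. *)
have [g [Q [gQ gD gQ0]]] := IH _ rC.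
exists (fun x => psum C x * nlog x ^+ k.+1 + (- b 0%N / k.+2%:R * nlog x ^+ k.+2 +
  k.+1%:R * g x)).
exists (C 0%N *: 'X^(k.+1) + ((- b 0%N / k.+2%:R) *: 'X^(k.+2) + k.+1%:R *: Q)); split.
- apply: log_seriesD; first exact: log_series_monomial.
  apply: log_seriesD; last exact: log_seriesZ.
  have := log_series_monomial k.+2 (@radius_delta _ rho 0 (- b 0%N / k.+2%:R)).
  by apply: log_series_ext => x _ _; rewrite psum_delta0.
- move=> x xr x0.
  have DL := is_derive_nlog x0.
  have D1 := is_deriveM (is_derive_psum rC (norm_lt_radius xr x0)) (is_deriveX k.+1 DL).
  have D2 := is_deriveZ (- b 0%N / k.+2%:R) (is_deriveX k.+2 DL).
  have D3 := is_deriveZ (k.+1%:R : R) (gD _ xr x0).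
  rewrite [X in is_derive _ _ X _](_ : _ = psum C * nlog ^+ k.+1 +
      ((- b 0%N / k.+2%:R) \*: nlog ^+ k.+2 + k.+1%:R \*: g)); last first.
    by apply/funext => y; rewrite /= !fctE.
  apply: is_derive_eq (is_deriveD D1 (is_deriveD D2 D3)) _.
  rewrite (psum_primitive rb xr x0) /GRing.scale /=.
  rewrite [(nlog ^+ k.+1) x](_ : _ = nlog x ^+ k.+1); last by rewrite fctE.
  have xn0 : x != 0 by rewrite lt_eqF.
  have kn0 : k.+2%:R != 0 :> R by rewrite pnatr_eq0.
  move: (k.+2%:R : R) (k.+1%:R : R) kn0 => p q p0.
  rewrite [nlog x ^+ k.+1]exprS; move: (psum C x) (nlog x) (nlog x ^+ k) => A B D.
  by field; rewrite xn0 p0.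
- by move=> b0; rewrite C0 b0 oppr0 mul0r !scale0r gQ0 // scaler0 !addr0.
Qed.

(** The factor 1/x accommodates the simple pole of the kernel of x1. The clause [P = 0 -> Q = 0]
    later makes the polynomial of a word beginning with x0 constant. *)
Lemma log_series_primitive rho h P : log_series rho h P ->
  exists g Q, [/\ log_series rho g Q,
    forall x, - rho < x -> x < 0 -> is_derive x 1 g (x^-1 * h x) &
    P = 0 -> Q = 0].
Proof.
move=> [c [m [rc /(_ m (leqnn m))[hE PE]]]].
have /choice[g] j := log_series_primitive_monomial j (rc j).
move=> /choice[Q H].
exists (fun x => \sum_(j < m) g j x), (\sum_(j < m) Q j); split.
- by apply: log_series_sum => j _; case: (H j).
- move=> x xr x0; rewrite hE // mulr_sumr.
  rewrite [X in is_derive _ _ X _](_ : _ = \sum_(j < m) (fun x => g j x)).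
    by apply: is_derive_sum => j; case: (H j) => _ /(_ x xr x0).
  by apply/funext => y; rewrite fct_sumE.
- move=> P0; apply: big1 => j _; case: (H j) => _ _; apply.
  by have := congr1 (fun p : {poly R} => p`_j) PE; rewrite P0 coef0 coef_poly ltn_ord.
Qed.

(** * Asymptotics at 0 and uniqueness of the polynomial of an expansion *)

Lemma cvg_nlog : nlog x @[x --> 0^'-] --> +oo.
Proof.
apply/cvgryPge => A; near=> x.
have x0 : 0 < - x by rewrite oppr_gt0; near: x; exact: nbhs_left_lt.
rewrite /nlog lerNr -ler_expR lnK ?posrE // lerNl.
by near: x; apply: nbhs_left_ge; rewrite oppr_lt0 expR_gt0.
Unshelve. all: by end_near. Qed.

Lemma cvg_nlogV : (nlog x)^-1 @[x --> 0^'-] --> 0.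
Proof.
apply/gtr0_cvgV0; last exact: cvg_nlog.
by have /cvgryPgt := cvg_nlog; apply.
Qed.

(* e^(-t) t^k <= (k+1)!/t at t = nlog x. *)
Lemma cvg_mul_nlog k : x * nlog x ^+ k @[x --> 0^'-] --> 0.
Proof.
have K : (k.+1)`!%:R * (nlog x)^-1 @[x --> 0^'-] --> (k.+1)`!%:R * (0 : R).
  by apply: cvgM; [exact: cvg_cst | exact: cvg_nlogV].
rewrite mulr0 in K; have KN := cvgN K; rewrite oppr0 in KN.
apply: (@squeeze_cvgr _ _ _ _ (fun x => - ((k.+1)`!%:R * (nlog x)^-1))
    (fun x => (k.+1)`!%:R * (nlog x)^-1)) => //; last exact: KN.
near=> x.
have x0 : x < 0 by near: x; exact: nbhs_left_lt.
have t0 : 0 < nlog x by near: x; have /cvgryPgt := cvg_nlog; apply.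
rewrite -ler_norml normrM (ger0_norm (exprn_ge0 _ (ltW t0))) ltr0_norm //.
rewrite ler_pdivlMr // -mulrA -exprSr -ler_pdivlMl ?oppr_gt0 //.
have -> : (- x)^-1 = expR (nlog x).
  by rewrite /nlog expRN lnK // posrE oppr_gt0.
rewrite -ler_pdivrMr ?ltr0n ?fact_gt0 //.
by apply: (le_trans _ (expR_ge1Dxn k (ltW t0))); rewrite lerDr ler01.
Unshelve. all: by end_near. Qed.

(** Each c_j(x) - c_j(0) is x times a function bounded near 0, and the factor x absorbs every power
    of L. *)
Lemma log_series_asymp rho h P k : 0 < rho -> log_series rho h P ->
  (h x - P.[nlog x]) * nlog x ^+ k @[x --> 0^'-] --> 0.
Proof.
move=> rho0 [c [m [rc /(_ m (leqnn m))[hE PE]]]].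
have r20 : 0 <= rho / 2 by rewrite divr_ge0 // ltW.
have r2 : rho / 2 < rho by lra.
have lim0 j : (psum (c j) x - c j 0%N) * nlog x ^+ (j + k) @[x --> 0^'-] --> 0.
  have [M HM] := psum_bounded (radius_shift (rc j)) r20 r2.
  have M0 : 0 <= M by have := HM 0; rewrite normr0 => /(_ r20); apply: le_trans.
  have K : `|M * (x * nlog x ^+ (j + k))| @[x --> 0^'-] --> `|M * 0|.
    by apply: cvg_norm; apply: cvgM; [exact: cvg_cst | exact: cvg_mul_nlog].
  rewrite mulr0 normr0 in K; apply/norm_cvg0P; apply: (squeeze_cvgr _ (cvg_cst 0) K).
  near=> x.
  have x0 : x < 0 by near: x; exact: nbhs_left_lt.
  have xr : - (rho / 2) < x by near: x; apply: nbhs_left_gt; rewrite oppr_lt0; lra.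
  have xN : `|x| < rho / 2 by apply: norm_lt_radius.
  rewrite normr_ge0 /= (psum_shift (rc j)) ?(lt_trans xN) // addrC addKr.
  rewrite mulrAC [leRHS]normrM mulrC normrM (ger0_norm M0) ler_wpM2r //.
  by apply: HM; apply: ltW.
have K : \sum_(j < m) ((psum (c j) x - c j 0%N) * nlog x ^+ (j + k))
    @[x --> 0^'-] --> \sum_(j < m) (0 : R).
  by apply: cvg_big => [|j _]; [exact: add_continuous | exact: lim0].
rewrite big1 // in K; apply: cvg_trans K; apply: near_eq_cvg; near=> x.
have x0 : x < 0 by near: x; exact: nbhs_left_lt.
have xr : - rho < x by near: x; apply: nbhs_left_gt; rewrite oppr_lt0.
rewrite hE // PE horner_poly -sumrB mulr_suml; apply: eq_bigr => j _.
by rewrite -mulrBl exprD mulrA.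
Unshelve. all: by end_near. Qed.

(* Divided by L^d, a polynomial of degree d in L tends to its leading
   coefficient. *)
Lemma horner_nlog_eq0 P : P.[nlog x] @[x --> 0^'-] --> 0 -> P = 0.
Proof.
move=> P0; apply/eqP; rewrite -lead_coef_eq0; apply/eqP.
(* [Q] is the reversed polynomial: Q(1/L) = P(L)/L^d, and Q(0) is the leading coefficient of [P]. *)
pose d := (size P).-1; pose Q := \poly_(i < d.+1) P`_(d - i).
have QV : Q.[(nlog x)^-1] @[x --> 0^'-] --> Q.[0].
  by apply: cvg_comp cvg_nlogV _; exact: continuous_horner.
have P0V : P.[nlog x] * (nlog x)^-1 ^+ d @[x --> 0^'-] --> 0 * (0 : R) ^+ d.
  apply: cvgM => //.
  by apply: (@cvg_comp _ _ _ _ (fun y => y ^+ d) _ _ _ cvg_nlogV); exact: exprn_continuous.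
have -> : lead_coef P = Q.[0] by rewrite horner_coef0 coef_poly /= subn0.
rewrite mul0r in P0V; apply: cvg_unique P0V => //; apply: cvg_trans QV.
apply: near_eq_cvg; near=> x.
have t0 : nlog x != 0.
  by rewrite gt_eqF //; near: x; have /cvgryPgt := cvg_nlog; apply.
rewrite horner_poly (@horner_coef_wide _ d.+1) ?leqSpred // mulr_suml.
rewrite (reindex_inj rev_ord_inj) /=; apply: eq_bigr => i _.
have id : (i <= d)%N by rewrite -ltnS.
rewrite subSS subKn // -mulrA; congr (_ * _).
have -> : (nlog x)^-1 ^+ d = (nlog x)^-1 ^+ i * (nlog x)^-1 ^+ (d - i).
  by rewrite -exprD subnKC.
by rewrite mulrA -exprMn divff // expr1n mul1r.
Unshelve. all: by end_near. Qed.

(** P(L) - Q(L) differs from h - g by o(1), hence tends to 0. Asking for a limit rather than h = g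
    allows Li_(x1)(e^x) to be compared with L. *)
Lemma log_series_unique rho rho' h g P Q : 0 < rho -> 0 < rho' ->
  log_series rho h P -> log_series rho' g Q ->
  h x - g x @[x --> 0^'-] --> 0 -> P = Q.
Proof.
move=> r0 r0' hP gQ hg; apply/eqP; rewrite -subr_eq0; apply/eqP.
apply: horner_nlog_eq0.
have hP0 := log_series_asymp 0 r0 hP; have gQ0 := log_series_asymp 0 r0' gQ.
have K : (h x - g x) + (g x - Q.[nlog x]) * nlog x ^+ 0 -
    (h x - P.[nlog x]) * nlog x ^+ 0 @[x --> 0^'-] --> (0 : R) + 0 - 0.
  by apply: cvgB => //; apply: cvgD.
rewrite addr0 subr0 in K; apply: cvg_trans K.
apply: near_eq_cvg; apply: nearW => x /=.
by rewrite !expr0 !mulr1 hornerD hornerN; ring.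
Qed.

(** In h g - P(L) Q(L) the errors h - P(L) and g - Q(L) are multiplied by each other or by
    polynomials in L, and both are smaller than every power of 1/L. For polylogarithms, the
    expansion of h g will come from the shuffle identity. *)
Lemma log_series_mul_unique rho h g P Q W : 0 < rho ->
  log_series rho h P -> log_series rho g Q ->
  log_series rho (fun x => h x * g x) W -> W = P * Q.
Proof.
move=> r0 hP gQ hgW; apply/eqP; rewrite -subr_eq0; apply/eqP.
apply: horner_nlog_eq0.
have H k := log_series_asymp k r0 hP; have G k := log_series_asymp k r0 gQ.
have mul0 F f : (forall k, f x * nlog x ^+ k @[x --> 0^'-] --> (0 : R)) ->
    F.[nlog x] * f x @[x --> 0^'-] --> 0.
  move=> f0; have : \sum_(i < size F) (F`_i * (f x * nlog x ^+ i)) @[x --> 0^'-]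
      --> \sum_(i < size F) (F`_i * 0).
    apply: cvg_big => [|i _]; first exact: add_continuous.
    by apply: cvgM (cvg_cst _) (f0 i).
  rewrite big1 => [|i _]; last by rewrite mulr0.
  apply: cvg_trans; apply: near_eq_cvg; apply: nearW => x /=.
  by rewrite horner_coef mulr_suml; apply: eq_bigr => i _; rewrite -mulrA [f x * _]mulrC.
have K : (h x - P.[nlog x]) * nlog x ^+ 0 * ((g x - Q.[nlog x]) * nlog x ^+ 0) +
    P.[nlog x] * (g x - Q.[nlog x]) + Q.[nlog x] * (h x - P.[nlog x]) -
    (h x * g x - W.[nlog x]) * nlog x ^+ 0 @[x --> 0^'-] --> (0 : R) * 0 + 0 + 0 - 0.
  apply: cvgB; last exact: log_series_asymp 0 r0 hgW.
  apply: cvgD; last exact: mul0.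
  by apply: cvgD; [apply: cvgM | apply: mul0].
rewrite mulr0 !addr0 subr0 in K; apply: cvg_trans K.
apply: near_eq_cvg; apply: nearW => x /=.
by rewrite !expr0 !mulr1 hornerD hornerN hornerM; ring.
Qed.

Lemma log_series_cvg rho h (a : R) : 0 < rho -> log_series rho h a%:P ->
  h x @[x --> 0^'-] --> a.
Proof.
move=> r0 ha; have := log_series_asymp 0 r0 ha => ha0.
have K : a + (h x - a%:P.[nlog x]) * nlog x ^+ 0 @[x --> 0^'-] --> a + 0.
  by apply: cvgD => //; exact: cvg_cst.
rewrite addr0 in K; apply: cvg_trans K; apply: near_eq_cvg; apply: nearW => x /=.
by rewrite expr0 mulr1 hornerC addrC subrK.
Qed.

End LogSeries.

(** * Polylogarithms near the singularity *)

Section Polylog.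
Variable R : realType.
Implicit Types (c e b : nat -> R) (w u v : word).

(* |b_(n+1)| <= sum_(i <= n) |e_(i+1)| |b_(n-i)| <= sum_i 2^-(i+1) <= 1. *)
Lemma conv_inverse e : e 0%N = 1 -> (forall n, `|e n| <= 2^-1 ^+ n) ->
  exists2 b, (forall n, `|b n| <= 1) & forall n, conv e b n = (n == 0)%:R.
Proof.
move=> e0 He.
(* The recursion for b_(n+1) uses all earlier values, so finite initial segments of the sequence are
   iterated. *)
pose next s := rcons s (- \sum_(i < size s) e i.+1 * nth 0 s ((size s).-1 - i)%N).
pose bs n := iter n next [:: 1 : R].
have sz n : size (bs n) = n.+1 by elim: n => //= n IH; rewrite size_rcons IH.
have bsS m n : (m <= n)%N -> nth 0 (bs n) m = nth 0 (bs m) m.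
  elim: n => [|n IH]; first by rewrite leqn0 => /eqP ->.
  rewrite leq_eqVlt => /orP[/eqP -> //|mn].
  by rewrite /= nth_rcons sz mn IH.
pose b n := nth 0 (bs n) n; have bS n : b n.+1 = - \sum_(i < n.+1) e i.+1 * b (n - i)%N.
  rewrite /b /= nth_rcons sz ltnn eqxx; congr (- _).
  by apply: eq_bigr => i _; rewrite /= (bsS (n - i)%N) // leq_subr.
exists b; last first.
  case=> [|n]; first by rewrite /conv big_ord1 e0 mul1r.
  rewrite /conv big_ord_recl e0 mul1r subn0 bS addrC.
  by apply/eqP; rewrite subr_eq0; apply/eqP; apply: eq_bigr.
elim/ltn_ind => -[|n] IH; first by rewrite /b /= normr1.
rewrite bS normrN; apply: le_trans (ler_norm_sum _ _ _) _.
apply: (@le_trans _ _ (\sum_(i < n.+1) 2^-1 ^+ i.+1)).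
  apply: ler_sum => i _; rewrite normrM -[leRHS]mulr1.
  by apply: ler_pM => //; apply: IH; rewrite ltnS leq_subr.
suff -> : \sum_(i < n.+1) 2^-1 ^+ i.+1 = 1 - 2^-1 ^+ n.+1 :> R.
  by rewrite gerBl exprn_ge0 // invr_ge0.
elim: n.+1 => [|k IHk]; first by rewrite big_ord0 expr0 subrr.
rewrite big_ord_recr /= IHk [2^-1 ^+ k.+1]exprS.
by move: (2^-1 ^+ k) => q; lra.
Qed.

(** The coefficients of E(x) = (e^x - 1)/x. *)
Definition exp_quotient n : R := (n.+1)`!%:R^-1.

Lemma exp_quotient_le n : `|exp_quotient n| <= 2^-1 ^+ n.
Proof.
rewrite /exp_quotient ger0_norm ?invr_ge0 // exprVn lef_pV2 ?posrE ?exprn_gt0 //.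
rewrite -natrX ler_nat; elim: n => // n IH.
by rewrite factS expnS leq_mul.
Qed.

Lemma radius_exp_quotient : has_radius 1 exp_quotient.
Proof.
apply: (@bounded_radius1 _ _ 1) => n; apply: le_trans (exp_quotient_le n) _.
by rewrite exprn_ile1 // ?invr_ge0 // invf_le1 // ler1n.
Qed.

Lemma expR_psum (x : R) : `|x| < 1 -> expR x = 1 + x * psum exp_quotient x.
Proof.
move=> x1; rewrite expRE -/(psum _ x) (@psum_shift _ 1) //; first by rewrite fact0 invr1.
apply: (@bounded_radius1 _ _ 1) => n; rewrite ger0_norm ?invr_ge0 //.
by rewrite invf_le1 ?ltr0n ?fact_gt0 // ler1n fact_gt0.
Qed.

(** With B the inverse of the series E of (e^x - 1)/x, one has e^x/(1 - e^x) = 1/(1 - e^x) - 1 = -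
    (B(x) + x)/x. *)
Lemma expR_kernel : exists2 b, has_radius 1 b &
  forall x : R, -1 < x -> x < 0 -> expR x / (1 - expR x) = x^-1 * psum b x.
Proof.
have [b b1 eb] := conv_inverse (invr1 _ : exp_quotient 0%N = 1) exp_quotient_le.
have rb := bounded_radius1 b1.
exists (fun n => -1 * (b n + if n == 1%N then 1 else 0)).
  by apply: radiusZ; apply: radiusD => //; exact: radius_delta.
move=> x x1 x0; have xn := norm_lt_radius x1 x0.
have rd := @radius_delta R 1 1 1.
rewrite (psumZ _ (radiusD rb rd) xn) (psumD rb rd xn) psum_delta1.
have := psum_conv radius_exp_quotient rb xn.
rewrite (_ : conv _ b = fun n => if n == 0%N then 1 else 0); last first.
  by apply/funext => n; rewrite eb; case: eqP.
rewrite psum_delta0 (expR_psum xn) => EB.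
have E0 : psum exp_quotient x != 0.
  by apply/eqP => E0; move: EB; rewrite E0 mul0r => /eqP; rewrite oner_eq0.
have -> : psum b x = (psum exp_quotient x)^-1 by rewrite -[LHS](mulKf E0) -EB mulr1.
have xn0 : x != 0 by rewrite lt_eqF.
have -> : 1 - (1 + x * psum exp_quotient x) = - (x * psum exp_quotient x) by ring.
by field; rewrite E0 xn0.
Qed.

Lemma eq_derive_cst (f g df : R -> R) (a b : R) :
  (forall x, a < x -> x < b -> is_derive x 1 f (df x)) ->
  (forall x, a < x -> x < b -> is_derive x 1 g (df x)) ->
  exists k, forall x, a < x -> x < b -> f x = g x + k.
Proof.
move=> Df Dg; have D x : a < x -> x < b -> is_derive x 1 (f - g) 0.
  by move=> ax xb; apply: is_derive_eq (is_deriveB (Df x ax xb) (Dg x ax xb)) (subrr _).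
have H x y : a < x -> x < y -> y < b -> (f - g) x = (f - g) y.
  move=> ax xy yb; have [z|z|z _ /eqP] := @MVT _ (f - g) (fun=> 0) x y xy.
  - by rewrite in_itv /= => /andP[xz zy]; apply: D; lra.
  - apply: derivable_within_continuous => {}z; rewrite in_itv /= => /andP[xz zy].
    by have [] : is_derive z 1 (f - g) 0 by apply: D; lra.
  - by rewrite mul0r subr_eq0 => /eqP.
have [ab|ba] := ltP a b; last by exists 0 => x ax xb; lra.
exists ((f - g) ((a + b) / 2)) => x ax xb.
suff <- : (f - g) x = (f - g) ((a + b) / 2) by rewrite !fctE; lra.
have [xm|mx|->//] := ltgtP x ((a + b) / 2); first by apply: H => //; lra.
by apply/esym/H => //; lra.
Qed.

Definition polylog w (x : R) : R := psum (coeff R w) (expR x).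

Lemma radius_coeff w : has_radius 1 (coeff R w).
Proof.
by apply: (@bounded_radius1 _ _ 1) => n; rewrite ger0_norm ?coeff_ge0 // coeff_le1.
Qed.

Lemma expR_norm_lt1 (x : R) : x < 0 -> `|expR x| < 1.
Proof. by move=> x0; rewrite ger0_norm ?expR_ge0 // expR_lt1. Qed.

(** By [coeffS] the n-th term is n times a number in [0, 1], so the derived geometric series is a
    majorant. *)
Lemma radius_letter_op l w : last x1 (l :: w) = x1 ->
  has_radius 1 (letter_op l (coeff R w)).
Proof.
move=> lw; have := radius_diffs (@bounded_radius1 R (fun=> 1) 1 _).
move=> /(_ (fun n => ltac:(by rewrite normr1))).
apply: (@radius_le _ _ _ _ 1) => n; rewrite mul1r -coeffS // /pseries_diffs mulr1.
rewrite normrM !normr_nat [ `|coeff _ _ _| ]ger0_norm ?coeff_ge0 //.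
apply: (@le_trans _ _ n%:R); first by rewrite ler_piMr // coeff_le1.
by rewrite ler_nat.
Qed.

(** The strict partial sums satisfy s_0 = 0 and s_(n+1) = s_n + c_n, so their series S satisfies S =
    z (S + C), where C is the series of the c_n. *)
Lemma psum_letter_op_x1 w (z : R) : `|z| < 1 -> last x1 w = x1 ->
  psum (letter_op x1 (coeff R w)) z = z / (1 - z) * psum (coeff R w) z.
Proof.
move=> z1 lw; have rl : has_radius 1 (letter_op x1 (coeff R w)).
  by apply: radius_letter_op; case: (w) lw.
have z10 : 1 - z != 0.
  by rewrite subr_eq0 eq_sym lt_eqF // (le_lt_trans (ler_norm z)).
have S0 := psum_shift rl z1; apply: (mulIf z10).
have {}S0 : psum (letter_op x1 (coeff R w)) z =
    z * (psum (letter_op x1 (coeff R w)) z + psum (coeff R w) z).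
  rewrite -(psumD rl (@radius_coeff w) z1) {1}S0.
  rewrite {1}/letter_op eqxx big_ord0 add0r; congr (_ * psum _ _).
  by apply/funext => n; rewrite /letter_op eqxx big_ord_recr.
move: (psum _ z) (psum _ z) S0 => S C SE.
by rewrite mulrBr mulr1 {1}SE; field.
Qed.

(** In the variable z = e^x, d/dx is Euler's operator z d/dz, which undoes the division by n in
    [coeff]. *)
Lemma is_derive_polylog l w (x : R) : last x1 (l :: w) = x1 -> x < 0 ->
  is_derive x 1 (polylog (l :: w))
    ((if l == x1 then expR x / (1 - expR x) else 1) * polylog w x).
Proof.
move=> lw x0; have zx := expR_norm_lt1 x0.
have := is_derive1_comp (is_derive_psum (radius_coeff (l :: w)) zx) (is_derive_expR x).
move=> D; apply: is_derive_eq D _.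
have rl := radius_letter_op lw.
transitivity (psum (letter_op l (coeff R w)) (expR x)).
  rewrite (psum_shift rl zx) -coeffS // mul0r add0r mulrC; congr (_ * psum _ _).
  by apply/funext => n; rewrite -coeffS.
rewrite /polylog; case: eqP => [lx|/eqP lx].
  rewrite lx psum_letter_op_x1 //.
  by move: lw; case: (w).
rewrite mul1r; congr psum; apply/funext => n.
by rewrite /letter_op (negbTE lx).
Qed.

Lemma psum_sum rho (I : Type) (s : seq I) (c : I -> nat -> R) (x : R) :
  (forall i, has_radius rho (c i)) -> `|x| < rho ->
  psum (fun n => \sum_(i <- s) c i n) x = \sum_(i <- s) psum (c i) x.
Proof.
move=> rc xr; elim: s => [|i s IH].
  rewrite big_nil; apply: lim_near_cst => //; apply: nearW => n.
  by rewrite /pseries /series /= big1 // => i _; rewrite big_nil mul0r.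
have rs : has_radius rho (fun n => \sum_(i <- s) c i n).
  elim: (s) => [|j t IHt] r r0 rr.
    by exists 0 => n; rewrite big_nil normr0 mul0r.
  have [M HM] := radiusD (rc j) IHt r0 rr.
  by exists M => n; rewrite big_cons.
rewrite big_cons -IH -(psumD (rc i) rs xr).
by congr psum; apply/funext => n; rewrite big_cons.
Qed.

Lemma polylog_shuffle u v (x : R) : last x1 u = x1 -> last x1 v = x1 -> x < 0 ->
  polylog u x * polylog v x = \sum_(w <- shuffle_word u v) polylog w x.
Proof.
move=> lu lv x0; have zx := expR_norm_lt1 x0.
rewrite /polylog -(psum_conv (radius_coeff u) (radius_coeff v) zx).
rewrite -(psum_sum _ (@radius_coeff) zx); congr psum; apply/funext => n.
exact: conv_coeff.
Qed.

(** By induction on the word, the polylogarithm and the primitive built from the expansion of the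
    tail have the same derivative on (-1, 0), so they differ by a constant. The default [x1] of
    [head] leaves the empty word out of the second claim. *)
Lemma polylog_log_series w : last x1 w = x1 ->
  exists2 P, log_series 1 (polylog w) P & head x1 w = x0 -> exists a, P = a%:P.
Proof.
elim: w => [_|l w IH lw].
  exists 1%:P => //; apply: log_series_ext (log_series_cst 1 1) => x _ x0.
  rewrite /polylog -[RHS](psum_delta0 1 (expR x)); congr psum; apply/funext => n /=.
  by case: eqP.
have [P wP _] : exists2 P, log_series 1 (polylog w) P & head x1 w = x0 -> exists a, P = a%:P.
  by apply: IH; move: lw; case: (w).
(* The derivative is multiplied by x to fit [log_series_primitive]. For x1 this cancels the pole;
   for x0 the factor x remains, and its value 0 at the origin kills the polynomial. *)
have [K [wK K0]] : exists K, log_series 1 (fun x => x *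
    ((if l == x1 then expR x / (1 - expR x) else 1) * polylog w x)) K /\
    (l = x0 -> K = 0).
  case: eqP => lx.
    have [b rb bE] := expR_kernel.
    exists (b 0%N *: P); split; last by rewrite lx.
    apply: log_series_ext (log_series_mul rb wP) => x x1' x0'.
    by rewrite bE // -mulrA mulVKf // lt_eqF.
  exists 0; split => //.
  have := log_series_mul (@radius_delta _ 1 1 1) wP; rewrite /= scale0r.
  by apply: log_series_ext => x _ _; rewrite psum_delta1 !mul1r.
have [g [Q [gQ gD Q0]]] := log_series_primitive wK.
have [a ha] : exists a, forall x, -1 < x -> x < 0 -> polylog (l :: w) x = g x + a.
  pose df x := (if l == x1 then expR x / (1 - expR x) else 1) * polylog w x.
  apply: (@eq_derive_cst (polylog (l :: w)) g df (-1) 0) => x xm x0'.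
    exact: is_derive_polylog.
  by have := gD _ xm x0'; rewrite mulKf // lt_eqF.
exists (Q + a%:P); first by apply: log_series_ext ha _; exact: log_seriesD (log_series_cst _ _).
by move=> /= lx; exists a; rewrite Q0 ?add0r //; exact: K0.
Qed.

Lemma psum_const1 (z : R) : `|z| < 1 -> psum (fun=> 1) z = (1 - z)^-1.
Proof.
move=> z1; have r1 : has_radius 1 (fun=> 1 : R).
  by apply: (@bounded_radius1 _ _ 1) => n; rewrite normr1.
have z10 : 1 - z != 0.
  by rewrite subr_eq0 eq_sym lt_eqF // (le_lt_trans (ler_norm z)).
have := psum_shift r1 z1; move: (psum _ z) => S SE.
by apply: (mulIf z10); rewrite mulVf // mulrBr mulr1 {1}SE; ring.
Qed.

Lemma psum_coeff_x1 (z : R) : 0 <= z -> z < 1 ->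
  psum (coeff R [:: x1]) z = - ln (1 - z).
Proof.
move=> z0 z1; pose f (y : R) := psum (coeff R [:: x1]) y + ln (1 - y).
have fD (y : R) : `|y| < 1 -> is_derive y 1 f 0.
  move=> y1; have y10 : 0 < 1 - y by rewrite subr_gt0 (le_lt_trans (ler_norm y)).
  have D1 := is_deriveB (is_derive_cst (1 : R) y (1 : R)) (is_derive_id y (1 : R)).
  have D2 : is_derive y 1 (@ln R \o (cst 1 - id)) ((1 - y)^-1 * (0 - 1)).
    by apply: is_derive1_comp; exact: is_derive1_ln.
  rewrite (_ : f = psum (coeff R [:: x1]) + (@ln R \o (cst 1 - id))) //.
  apply: is_derive_eq (is_deriveD (is_derive_psum (@radius_coeff [:: x1]) y1) D2) _.
  rewrite sub0r mulrN1 -(psum_const1 y1); apply/eqP; rewrite subr_eq0; apply/eqP.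
  congr psum; apply/funext => n; rewrite /pseries_diffs.
  rewrite (@coeffS _ x1 [::]) // /letter_op eqxx big_ord_recl /= big1 ?addr0 //.
have f0 : f 0 = 0.
  rewrite /f subr0 ln1 addr0 (psum_shift (@radius_coeff _)) ?normr0 // mul0r addr0.
  exact: coeff_cons0.
suff fz : f z = 0 by move/eqP: fz; rewrite /f addr_eq0 => /eqP.
move: z0; rewrite le_eqVlt => /orP[/eqP <- //|z0].
have [y|y|y _] := @MVT _ f (fun=> 0) 0 z z0.
- by rewrite in_itv /= => /andP[y0 yz]; apply: fD; rewrite gtr0_norm // (lt_trans yz).
- apply: derivable_within_continuous => {}y; rewrite in_itv /= => /andP[y0 yz].
  have [] : is_derive y 1 f 0 by apply: fD; rewrite ger0_norm // (le_lt_trans yz).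
  by [].
- by rewrite f0 subr0 mul0r.
Qed.

(** Since 1 - e^x = - x E(x) with E(x) = (e^x - 1)/x, the difference is - ln E(x), and E(0) = 1. *)
Lemma cvg_polylog_x1 : polylog [:: x1] x - nlog x @[x --> 0^'-] --> 0.
Proof.
have E0 : psum exp_quotient (0 : R) = 1.
  rewrite (psum_shift radius_exp_quotient) ?normr0 // mul0r addr0.
  by rewrite /exp_quotient invr1.
have K : - ln (psum exp_quotient x) @[x --> (0 : R)^'-] --> - ln (1 : R).
  have Ec : psum exp_quotient x @[x --> (0 : R)^'-] --> (1 : R).
    apply: cvg_at_left_filter; rewrite -E0.
    have n0 : `|0 : R| < 1 by rewrite normr0.
    have [D _] := is_derive_psum radius_exp_quotient n0.
    by apply/differentiable_continuous/derivable1_diffP.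
  apply: cvgN; apply: (@cvg_comp _ _ _ (psum exp_quotient) (@ln R) _ _ _ Ec).
  exact: continuous_ln ltr01.
rewrite ln1 oppr0 in K; apply: cvg_trans K; apply: near_eq_cvg; near=> x.
have x0 : x < 0 by near: x; exact: nbhs_left_lt.
have xm : -1 < x by near: x; apply: nbhs_left_gt; rewrite oppr_lt0.
have xn := norm_lt_radius xm x0.
have ex1 : expR x < 1 by rewrite expR_lt1.
rewrite /polylog psum_coeff_x1 ?expR_ge0 // /nlog opprK.
have E : 1 - expR x = - x * psum exp_quotient x by rewrite (expR_psum xn); ring.
have Epos : 0 < psum exp_quotient x.
  by rewrite -(pmulr_rgt0 _ (_ : 0 < - x)) ?oppr_gt0 // -E subr_gt0.
by rewrite E lnM ?posrE ?oppr_gt0 // opprD addrAC addNr add0r.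
Unshelve. all: by end_near. Qed.

(* By monotonicity, an expansion whose regular part is a constant [a] forces
   the series at z = 1 to converge to [a] (Abel). *)
Lemma series_coeff_cvg w (a : R) : log_series 1 (polylog w) a%:P ->
  series (coeff R w) @ \oo --> a.
Proof.
move=> wa; have wlim := log_series_cvg ltr01 wa.
have nd : nondecreasing_seq (series (coeff R w)).
  by apply: nondecreasing_series => n _ _; exact: coeff_ge0.
have partial (x : R) N : x < 0 -> pseries (coeff R w) (expR x) N <= polylog w x.
  move=> x0; apply: nondecreasing_cvgn_le.
    apply: nondecreasing_series => n _ _.
    by rewrite mulr_ge0 ?coeff_ge0 // exprn_ge0 // expR_ge0.
  exact: (is_cvg_pseries (@radius_coeff w) (expR_norm_lt1 x0)).
(* A partial sum is a polynomial in e^x bounded by Li_w(e^x); as x tends to 0, its value at z = 1 is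
   bounded by [a]. *)
have le_a N : series (coeff R w) N <= a.
  pose P := \poly_(i < N) coeff R w i.
  have PE (z : R) : P.[z] = pseries (coeff R w) z N.
    by rewrite horner_poly /pseries /series /= big_mkord.
  have -> : series (coeff R w) N = P.[expR 0].
    by rewrite expR0 PE /pseries /series /=; apply: eq_bigr => i _; rewrite expr1n mulr1.
  have Pc : P.[expR x] @[x --> (0 : R)^'-] --> P.[expR 0].
    apply: cvg_at_left_filter; apply: continuous_comp; first exact: continuous_expR.
    exact: continuous_horner.
  apply: (ler_cvg_to Pc wlim); near=> x; rewrite PE; apply: partial.
  by near: x; exact: nbhs_left_lt.
have cS : cvgn (series (coeff R w)).
  by apply: nondecreasing_is_cvgn => //; exists a => _ [N _ <-].
suff -> : a = limn (series (coeff R w)) by [].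
apply/eqP; rewrite eq_le; apply/andP; split; last first.
  by apply: limr_le => //; exact: nearW.
(* Conversely Li_w(e^x) is at most the sum of the coefficients, as e^x < 1. *)
apply: (cvgr_to_le wlim); near=> x.
have x0 : x < 0 by near: x; exact: nbhs_left_lt.
apply: ler_lim => //.
  exact: (is_cvg_pseries (@radius_coeff w) (expR_norm_lt1 x0)).
apply: nearW => N; rewrite /pseries /series /=; apply: ler_sum => n _.
by rewrite ler_piMr ?coeff_ge0 // exprn_ile1 ?expR_ge0 // ltW // expR_lt1.
Unshelve. all: by end_near. Qed.

End Polylog.

(** * Multiple zeta values and polylogarithms as sums over indices *)

Section NestedSums.
Variable R : realType.
Implicit Types (s n : seq nat).

Lemma comp_term_ge0 s n : 0 <= comp_term R s n.
Proof. by apply: prodr_ge0 => p _; rewrite invr_ge0 exprn_ge0. Qed.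

(** A block x0^k x1 accounts for one summation index N, with exponent k+1 and the next index below
    N. *)
Lemma coeff_x0x1 k w N :
  coeff R (nseq k x0 ++ x1 :: w) N = N%:R ^- k.+1 * \sum_(m < N) coeff R w m.
Proof.
elim: k => [|k IH]; first by rewrite /= /letter_op eqxx mulrC expr1.
rewrite /= /letter_op /= IH mulrAC -invfM -exprSr; case: N {IH} => [|N] //.
Qed.

(** Slicing by the first index corresponds to taking the coefficient of z^N. The empty index has
    head 0 by default and lies in slice 0, as the empty word has the series 1. *)
Definition head_slice k N : set (seq nat) :=
  [set n | decreasing_indices k n /\ head 0%N n = N].

Lemma decreasing_indices_cons k N n : decreasing_indices k.+1 (N :: n) <->
  [/\ (0 < N)%N, decreasing_indices k n & (head 0%N n < N)%N].
Proof.
rewrite /decreasing_indices /=; split=> [[[sn] pn /andP[N0 an]]|[N0 [sn pn an] hn]].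
  by split=> //; [split=> //; exact: path_sorted pn | case: (n) pn => //= m n' /andP[]].
split; [by rewrite sn | | by rewrite N0].
by case: n pn hn {sn an} => //= m n -> ->.
Qed.

Lemma trivIset_head_slice k (D : set nat) : trivIset D (head_slice k).
Proof. by move=> i j _ _ [n [[_ <-] [_ <-]]]. Qed.

Lemma decreasing_indices_slices k :
  decreasing_indices k = \bigcup_(N in [set: nat]) head_slice k N.
Proof.
by apply/seteqP; split => [n dn|n [N _ []]] //; exists (head 0%N n).
Qed.

(** The weight [K] absorbs the factor n_1^(-s_1) when the first index is peeled off in the
    induction. *)
Lemma esum_head_slice s N (K : R) : composition s -> 0 <= K ->
  \esum_(n in head_slice (size s) N) (K * comp_term R s n)%:E =
  (K * coeff R (word_of_comp s) N)%:E.
Proof.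
move=> + K0; elim: s N K K0 => [|p s IH] N K K0.
  move=> _; rewrite /=; have [->|N0] := eqVneq N 0%N.
    rewrite (_ : head_slice _ _ = [set [::]]).
      by rewrite esum_set1 /comp_term big_nil // lee_fin mulr1.
    by apply/seteqP; split => [n [[/size0nil ->]]|n ->].
  rewrite mulr0 (_ : head_slice _ _ = set0) ?esum_set0 //.
  by apply/seteqP; split => // n [[/size0nil -> _ _]] /= NE; rewrite -NE in N0.
case/andP; case: p => // p _ cs.
rewrite word_of_comp_cons coeff_x0x1; case: N => [|N].
  rewrite big_ord0 !mulr0 (_ : head_slice _ _ = set0) ?esum_set0 //.
  apply/seteqP; split => // -[|m n] [].
    by case.
  by move=> /decreasing_indices_cons[m0 _ _] /= mE; rewrite mE in m0.
(* After the first index N+1 comes a tail with head M <= N, where M = 0 arises only from the empty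
   tail. *)
have -> : head_slice (size (p.+1 :: s)) N.+1 =
    cons N.+1 @` (\bigcup_(M in `I_N.+1) head_slice (size s) M).
  apply/seteqP; split => [[|m n] [] |_ [n [M /= MN [dn hn]] <-]].
  - by case.
  - move=> /decreasing_indices_cons[m0 dn hn] /= mE; rewrite mE in hn *.
    by exists n => //; exists (head 0%N n).
  - by split=> //; apply/decreasing_indices_cons; split; rewrite ?hn.
rewrite esum_image; last by move=> a b _ _ [].
rewrite esum_bigcupT; last 2 first.
- exact: trivIset_head_slice.
- by move=> n; rewrite lee_fin mulr_ge0 // comp_term_ge0.
pose K' := K * N.+1%:R ^- p.+1.
have K'0 : 0 <= K' by rewrite mulr_ge0 // invr_ge0 exprn_ge0.
rewrite mulrA -/K' mulr_sumr.
rewrite (eq_esum (b := fun M => (K' * coeff R (word_of_comp s) M)%:E)); last first.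
  move=> M _; rewrite -IH //; apply: eq_esum => n _.
  by rewrite /comp_term /= big_cons mulrA.
rewrite esum_fset //; last first.
  by move=> M _; rewrite lee_fin mulr_ge0 // coeff_ge0.
by rewrite -fsbig_ord sumEFin.
Qed.

(* [mzv] is the case of the weight 1, [Li_exp] that of the weight e^(n_1 x). *)
Lemma esum_decreasing_indices s (g : nat -> R) (l : R) :
  composition s -> (forall N, 0 <= g N) ->
  series (fun N => g N * coeff R (word_of_comp s) N) @ \oo --> l ->
  \esum_(n in decreasing_indices (size s))
    (g (head 0%N n) * comp_term R s n)%:E = l%:E.
Proof.
move=> cs g0 gl; rewrite decreasing_indices_slices esum_bigcupT; last 2 first.
- exact: trivIset_head_slice.
- by move=> n; rewrite lee_fin mulr_ge0 // comp_term_ge0.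
rewrite (eq_esum (b := fun N => (g N * coeff R (word_of_comp s) N)%:E)); last first.
  move=> N _; rewrite -esum_head_slice //; apply: eq_esum => n [_ <-] //.
rewrite -nneseries_esumT; last first.
  by move=> N; rewrite lee_fin mulr_ge0 // coeff_ge0.
apply/cvg_lim => //; rewrite [X in X @ _ --> _](_ : _ =
    EFin \o series (fun N => g N * coeff R (word_of_comp s) N)).
  by apply: cvg_EFin => //; exact: nearW.
by apply/funext => n /=; rewrite /series /= sumEFin.
Qed.

Lemma Li_expE s (x : R) : composition s -> x < 0 ->
  Li_exp s x = polylog (word_of_comp s) x.
Proof.
move=> cs x0; rewrite /Li_exp.
rewrite (@esum_decreasing_indices s (fun N => expR (N%:R * x)) (polylog (word_of_comp s) x)) //.
rewrite [X in series X](_ : _ = fun N => coeff R (word_of_comp s) N * expR x ^+ N).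
  exact: is_cvg_pseries (@radius_coeff R (word_of_comp s)) (expR_norm_lt1 x0).
by apply/funext => N; rewrite mulrC expRM_natl.
Qed.

Lemma mzvE s (a : R) : composition s ->
  log_series 1 (polylog (word_of_comp s)) a%:P -> mzv R s = a.
Proof.
move=> cs /series_coeff_cvg wa; rewrite /mzv.
rewrite (eq_esum (b := fun n => (1 * comp_term R s n)%:E)); last first.
  by move=> n _; rewrite mul1r.
rewrite (@esum_decreasing_indices s (fun=> 1) a) //.
by under [X in series X]funext do rewrite mul1r.
Qed.

End NestedSums.

(** * Complex coefficients *)

Section ComplexSeries.
Variable R : realType.
Implicit Types (z : R[i]) (x : R) (c : nat -> R).

Local Open Scope complex_scope.

Lemma norm_real_complex x : `|x%:C| = `|x|%:C.
Proof. by rewrite normc_def /= expr0n addr0 sqrtr_sqr. Qed.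

Lemma normc_ge_Re z : `|complex.Re z|%:C <= `|z|.
Proof.
by rewrite normc_def lecR -[leLHS]sqrtr_sqr ler_sqrt ?lerDl ?addr_ge0 ?sqr_ge0.
Qed.

Lemma normc_ge_Im z : `|complex.Im z|%:C <= `|z|.
Proof.
by rewrite normc_def lecR -[leLHS]sqrtr_sqr ler_sqrt ?lerDr ?addr_ge0 ?sqr_ge0.
Qed.

Lemma normc_le_parts z : `|z| <= (`|complex.Re z| + `|complex.Im z|)%:C.
Proof.
rewrite {1}[z]complexE rmorphD /=; apply: le_trans (ler_normD _ _) _.
rewrite normrM !norm_real_complex lerD2l.
by rewrite normc_def /= expr0n expr1n add0r sqrtr1 mul1r.
Qed.

Lemma cvg_parts (u : nat -> R[i]^o) (l : R[i]^o) :
  (fun n => complex.Re (u n)) @ \oo --> complex.Re l ->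
  (fun n => complex.Im (u n)) @ \oo --> complex.Im l -> u @ \oo --> l.
Proof.
move=> /cvgrPdist_lt uRe /cvgrPdist_lt uIm; apply/cvgrPdist_lt => -[e e'].
rewrite ltcE /= => /andP[/eqP -> e0].
have e20 : 0 < e / 2 by rewrite divr_gt0.
near=> n; apply: le_lt_trans (normc_le_parts _) _; rewrite ltcR.
rewrite [ltRHS]splitr; apply: ltrD.
  have -> : complex.Re (l - u n) = complex.Re l - complex.Re (u n).
    by case: (l) (u n) => a b [].
  by near: n; exact: uRe.
have -> : complex.Im (l - u n) = complex.Im l - complex.Im (u n).
  by case: (l) (u n) => a b [].
by near: n; exact: uIm.
Unshelve. all: by end_near. Qed.

Lemma cvg_part (f : R[i] -> R) (u : nat -> R[i]^o) (l : R[i]^o) :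
  {morph f : z w / z - w} -> (forall z, `|f z|%:C <= `|z|) ->
  u @ \oo --> l -> (fun n => f (u n)) @ \oo --> f l.
Proof.
move=> fB fN /cvgrPdist_lt ul; apply/cvgrPdist_lt => e e0.
have e0C : 0 < e%:C by rewrite ltcR.
near=> n; rewrite -fB -ltcR; apply: le_lt_trans (fN _) _.
by near: n; exact: ul.
Unshelve. all: by end_near. Qed.

(** The real and the imaginary parts are both dominated by the terms |c_n| |z|^n. *)
Lemma power_series_cvg c z : has_radius 1 c -> `|z| < 1%:C ->
  cvgn (power_series (fun n => (c n)%:C) z).
Proof.
move=> rc z1; have [t zt] : exists t : R, `|z| = t%:C.
  by rewrite normc_def; eexists.
have t0 : 0 <= t by rewrite -ler0c -zt normr_ge0.
have t1 : t < 1 by rewrite -ltcR -zt.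
have part_cvg (f : R[i] -> R) : (forall x y, f (x%:C * y) = x * f y) ->
    (forall y, `|f y|%:C <= `|y|) -> cvgn (series (fun n => f ((c n)%:C * z ^+ n))).
  move=> fM fN; apply: normed_cvg.
  have rcN : has_radius 1 (fun n => `|c n|).
    by apply: (@radius_le _ _ c _ 1) => // n; rewrite normr_id mul1r.
  have tn : `|t| < 1 by rewrite ger0_norm.
  apply: (@series_le_cvg _ _ (fun n => `|c n| * t ^+ n)) => [n|n|n|].
  - exact: normr_ge0.
  - by rewrite mulr_ge0 // exprn_ge0.
  - rewrite /= fM normrM ler_wpM2l // -lecR; apply: le_trans (fN _) _.
    by rewrite normrX zt rmorphXn.
  - exact: (is_cvg_pseries rcN tn).
have ReM x y : complex.Re (x%:C * y) = x * complex.Re y.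
  by case: y => a b /=; rewrite mul0r subr0.
have ImM x y : complex.Im (x%:C * y) = x * complex.Im y.
  by case: y => a b /=; rewrite mul0r addr0.
have /cvg_ex[a Ha] := part_cvg _ ReM normc_ge_Re.
have /cvg_ex[b Hb] := part_cvg _ ImM normc_ge_Im.
apply/cvg_ex; exists (a +i* b); apply: cvg_parts.
  apply: cvg_trans Ha; apply: near_eq_cvg; apply: nearW => n.
  rewrite /power_series /series /=.
  by rewrite (big_morph (@complex.Re R) (id1 := 0) (op1 := +%R)) // => -[? ?] [].
apply: cvg_trans Hb; apply: near_eq_cvg; apply: nearW => n.
rewrite /power_series /series /=.
by rewrite (big_morph (@complex.Im R) (id1 := 0) (op1 := +%R)) // => -[? ?] [].
Qed.

Lemma lim_power_series c x : has_radius 1 c -> `|x| < 1 ->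
  limn (power_series (fun n => (c n)%:C) x%:C) = (psum c x)%:C.
Proof.
move=> rc x1; have E n : power_series (fun n => (c n)%:C) x%:C n = (pseries c x n)%:C.
  rewrite /power_series /pseries /series /= rmorph_sum; apply: eq_bigr => i _.
  by rewrite rmorphM rmorphXn.
apply: cvg_lim; first exact: norm_hausdorff.
apply: cvg_parts.
  under [X in X @ _]funext do rewrite E.
  exact: (is_cvg_pseries rc x1).
under [X in X @ _]funext do rewrite E.
exact: cvg_cst.
Qed.

Lemma log_series_regularized h (P : {poly R}) : log_series 1 h P ->
  regularized_value h (map_poly (real_complex R) P).
Proof.
move=> [c [m [rc /(_ m.+1 (leqnSn m))[hE PE]]]].
exists m, (fun j n => (c j n)%:C); split; last first.
  apply/polyP => i; rewrite coef_map PE !coef_poly.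
  by case: ifP.
split=> [j _|]; first by exists 1 => // z; exact: power_series_cvg.
near=> x.
have x0 : x < 0 by near: x; exact: nbhs_left_lt.
have xm : -1 < x by near: x; apply: nbhs_left_gt; rewrite oppr_lt0.
rewrite hE // rmorph_sum; apply: eq_bigr => j _.
by rewrite rmorphM /= lim_power_series // norm_lt_radius.
Unshelve. all: by end_near. Qed.

(** Used for the real and the imaginary part as f. Since x and L are real, f applied to the
    coefficients of a complex expansion gives a real one. *)
Lemma log_expansion_part (f : R[i] -> R) h m (c : nat -> nat -> R[i]) :
  {morph f : z w / z + w} -> (forall z x, f (z * x%:C) = f z * x) ->
  (forall z, `|f z|%:C <= `|z|) -> log_expansion h m c ->
  exists2 r, 0 < r &
    log_series r (fun x => f (h x)%:C) (\poly_(j < m.+1) f (c j 0%N)).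
Proof.
move=> fD fM fN [Hc [d /= d0 Hd]].
have f0 : f 0 = 0 by apply: (addIr (f 0)); rewrite -fD !add0r.
have fB : {morph f : z w / z - w}.
  by move=> z w; apply: (addIr (f w)); rewrite -fD !subrK.
have fsum (I : Type) (s : seq I) (F : I -> R[i]) :
    f (\sum_(i <- s) F i) = \sum_(i <- s) f (F i).
  exact: (big_morph f fD f0).
(* A common radius is the minimum over the finitely many coefficient series. *)
have [r r0 Hr] : exists2 r, 0 < r & forall j, (j <= m)%N ->
    forall z, `|z| < r%:C -> cvgn (power_series (c j) z).
  suff : forall k, (k <= m.+1)%N -> exists2 r, 0 < r & forall j, (j < k)%N ->
      forall z, `|z| < r%:C -> cvgn (power_series (c j) z).
    by move=> /(_ m.+1 (leqnn _)).
  elim=> [|k IH] km; first by exists 1.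
  have [r r0 Hr] := IH (ltnW km); have [s s0 Hs] := Hc k km.
  exists (Num.min r s); first by rewrite lt_min r0.
  move=> j; rewrite ltnS leq_eqVlt => /orP[/eqP ->|jk] z zm.
    by apply: Hs; apply: lt_le_trans zm _; rewrite lecR ge_min lexx orbT.
  by apply: (Hr j) => //; apply: lt_le_trans zm _; rewrite lecR ge_min lexx.
have part_cvg j x : (j <= m)%N -> `|x| < r ->
    pseries (fun n => f (c j n)) x @ \oo --> f (limn (power_series (c j) x%:C)).
  move=> jm xr; have := Hr j jm x%:C; rewrite norm_real_complex ltcR => /(_ xr) cc.
  have := cvg_part fB fN cc; apply: cvg_trans; apply: near_eq_cvg; apply: nearW => n.
  rewrite /power_series /pseries /series /= fsum; apply: eq_bigr => i _.
  by rewrite -rmorphXn fM.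
(* Zero coefficient series beyond [m] make one expansion serve all orders N > m. *)
pose c' j n := if (j <= m)%N then f (c j n) else 0.
exists (Num.min r d); first by rewrite lt_min r0.
exists c', m.+1; split=> [j|N mN].
  rewrite /c'; case: (leqP j m) => jm; last first.
    by move=> s _ _; exists 0 => n; rewrite normr0 mul0r.
  move=> s s0; rewrite lt_min => /andP[sr _].
  have sn : `|s| < r by rewrite ger0_norm.
  (* A convergent series has bounded terms, which is the form of [has_radius]. *)
  have /cvgP/cvg_series_bounded[K [_ HK]] := part_cvg j s jm sn.
  exists (K + 1) => n; have := HK (K + 1) _ n; rewrite ltrDl ltr01 => /(_ isT I).
  by rewrite /= normrM normrX (ger0_norm s0).
split=> [x|].
  rewrite ltrNl lt_min => /andP[xr xd] x0.
  have xn : `|x| < r by rewrite ltr0_norm.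
  rewrite (Hd x) //; last by rewrite /ball /= sub0r normrN ltr0_norm.
  rewrite fsum -(big_mkord xpredT (fun j => psum (c' j) x * nlog x ^+ j)).
  rewrite (@big_cat_nat _ _ _ m.+1) //= [X in _ = _ + X]big_nat [X in _ = _ + X]big1 ?addr0.
    rewrite big_mkord; apply: eq_bigr => j _; rewrite fM; congr (_ * _).
    rewrite /c' -ltnS ltn_ord; apply/esym/cvg_lim => //.
    by apply: part_cvg; rewrite // -ltnS.
  move=> j /andP[mj _]; rewrite /c' leqNgt mj /= (_ : psum _ _ = 0) ?mul0r //.
  apply: lim_near_cst => //; apply: nearW => n.
  by rewrite /pseries /series /= big1 // => i _; rewrite mul0r.
apply/polyP => i; rewrite !coef_poly /c' ltnS; case: (leqP i m) => im.
  by rewrite (leq_trans _ mN).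
by case: ifP.
Qed.

(** The real parts of the coefficients expand h and the imaginary parts expand 0. Real uniqueness
    determines the former at x = 0 and annihilates the latter there. *)
Lemma regularized_value_unique h (P : {poly R}) p : log_series 1 h P ->
  regularized_value h p -> p = map_poly (real_complex R) P.
Proof.
move=> hP [m [c [hc ->]]].
have ReM z x : complex.Re (z * x%:C) = complex.Re z * x.
  by case: z => a b /=; rewrite mulr0 subr0.
have ImM z x : complex.Im (z * x%:C) = complex.Im z * x.
  by case: z => a b /=; rewrite mulr0 add0r.
have ReD : {morph @complex.Re R : z w / z + w} by move=> [? ?] [].
have ImD : {morph @complex.Im R : z w / z + w} by move=> [? ?] [].
have [r r0 /= hRe] := log_expansion_part ReD ReM normc_ge_Re hc.
have [s s0 /= hIm] := log_expansion_part ImD ImM normc_ge_Im hc.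
have cvg0 (g : R -> R) : g x - g x @[x --> (0 : R)^'-] --> (0 : R).
  by under [X in X @ _]funext do rewrite subrr; exact: cvg_cst.
have PE := log_series_unique ltr01 r0 hP hRe (cvg0 h).
have QE := log_series_unique ltr01 s0 (log_series_cst 1 0) hIm (cvg0 _).
apply/polyP => i; rewrite coef_map PE !coef_poly.
have := congr1 (fun q : {poly R} => q`_i) QE; rewrite coefC coef_poly if_same.
case: ifP => // _ Im0; rewrite {1}[c i 0%N]complexE -Im0 /=.
by rewrite rmorph0 mulr0 addr0.
Qed.

End ComplexSeries.

(** * The regularized values form a shuffle homomorphism *)

Section Regularization.
Variable R : realType.
Implicit Types (f g : Hsh) (u v w : word).

Definition word_poly w : {poly R} :=
  xget 0 [set P | log_series 1 (polylog w) P].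

(** The real map with which both [Zsh] and [ZRB] are compared on H1. *)
Definition reg : Hsh -> {poly R} := mmap (polyC \o (ratr : rat -> R)) word_poly.

Lemma word_poly_log_series w : last x1 w = x1 ->
  log_series 1 (polylog w) (word_poly w).
Proof.
by case/(@polylog_log_series R) => P wP _; apply: (xgetPex 0); exists P.
Qed.

Lemma word_poly_unique w (h : R -> R) P : last x1 w = x1 -> log_series 1 h P ->
  polylog w x - h x @[x --> 0^'-] --> 0 -> word_poly w = P.
Proof. by move=> /word_poly_log_series; exact: log_series_unique. Qed.

Lemma reg_sumE f : reg f = \sum_(w <- msupp f) ratr f@_w *: word_poly w.
Proof. by rewrite /reg mmapE; apply: eq_bigr => w _; rewrite mul_polyC. Qed.

Lemma regU (a : rat) w : reg << a *g w >> = ratr a *: word_poly w.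
Proof. by rewrite /reg mmapU mul_polyC. Qed.

Lemma regD f g : reg (f + g) = reg f + reg g.
Proof. exact: raddfD. Qed.

Lemma regB f g : reg (f - g) = reg f - reg g.
Proof. exact: raddfB. Qed.

Lemma reg_sum (I : Type) (s : seq I) (F : I -> Hsh) :
  reg (\sum_(i <- s) F i) = \sum_(i <- s) reg (F i).
Proof. exact: raddf_sum. Qed.

Lemma regZ (a : rat) f : reg (a *: f) = ratr a *: reg f.
Proof.
rewrite (monalg_sumZ f) scaler_sumr !reg_sum scaler_sumr; apply: eq_bigr => w _.
by rewrite scalerA -!monalgU_scale !regU rmorphM scalerA.
Qed.

Lemma word_poly_nil : word_poly [::] = 1.
Proof.
apply: (word_poly_unique _ (log_series_cst 1 1)) => //.
rewrite [X in X @ _](_ : _ = fun=> 0); first exact: cvg_cst.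
apply/funext => x; apply/eqP; rewrite subr_eq0; apply/eqP.
rewrite /polylog -[RHS](psum_delta0 1 (expR x)); congr psum; apply/funext => n /=.
by case: eqP.
Qed.

Lemma word_poly_x1 : word_poly [:: x1] = 'X.
Proof.
have nlogX : log_series 1 (@nlog R) 'X.
  have := log_series_monomial 1 (@radius_delta R 1 0 1); rewrite /= scale1r expr1.
  by apply: log_series_ext => x _ _; rewrite psum_delta0 mul1r expr1.
by apply: (word_poly_unique _ nlogX) => //; exact: cvg_polylog_x1.
Qed.

(** By [polylog_shuffle], the expansions of the shuffled words add up to an expansion of the
    product. *)
Lemma word_poly_mul u v : last x1 u = x1 -> last x1 v = x1 ->
  word_poly u * word_poly v = \sum_(w <- shuffle_word u v) word_poly w.
Proof.
move=> lu lv; apply/esym; apply: (log_series_mul_unique ltr01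
  (word_poly_log_series lu) (word_poly_log_series lv)).
have H w : w \in shuffle_word u v -> log_series 1 (polylog w) (word_poly w).
  by move=> wuv; apply: word_poly_log_series; apply: last_shuffle wuv.
apply: log_series_ext (log_series_sum H) => x _ x0.
exact: polylog_shuffle.
Qed.

Lemma word_poly_mzv w : last x1 w = x1 -> head x0 w = x0 ->
  word_poly w = (mzv R (comp_of_word w))%:P.
Proof.
move=> lw hw; have [a wa] : exists a, word_poly w = a%:P.
  case: w lw hw => [_ _|l w lw lx0]; first by exists 1; rewrite word_poly_nil.
  have [P wP /(_ lx0)[a PE]] := polylog_log_series R lw.
  exists a; rewrite -PE; apply: (word_poly_unique lw wP).
  by under [X in X @ _]funext do rewrite subrr; exact: cvg_cst.
rewrite wa; congr _%:P; have := word_poly_log_series lw; rewrite wa.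
by case/word_of_compP: lw => s cs ->; rewrite word_of_compK // => /(mzvE cs).
Qed.

Lemma reg_shuffle f g : H1 f -> H1 g -> reg (shuffle f g) = reg f * reg g.
Proof.
move=> /H1P Hf /H1P Hg; rewrite /shuffle reg_sum (reg_sumE f) mulr_suml.
rewrite big_seq [RHS]big_seq; apply: eq_bigr => u /Hf lu.
rewrite reg_sum (reg_sumE g) mulr_sumr big_seq [RHS]big_seq.
apply: eq_bigr => v /Hg lv; rewrite reg_sum.
under eq_bigr do rewrite regU.
by rewrite -scaler_sumr -word_poly_mul // -scalerAl -scalerAr scalerA rmorphM.
Qed.

Lemma reg_zeta f : H0 f -> reg f = (zeta_sh R f)%:P.
Proof.
move=> /H0P Hf; rewrite reg_sumE /zeta_sh mmapE rmorph_sum big_seq [RHS]big_seq.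
apply: eq_bigr => w /Hf[lw hw].
by rewrite word_poly_mzv // rmorphM /= mul_polyC.
Qed.

Lemma reg_shuffle_regularization : shuffle_regularization reg.
Proof.
split.
- by move=> a f g _ _; rewrite regD regZ.
- by rewrite regU rmorph1 scale1r word_poly_nil.
- exact: reg_shuffle.
- exact: reg_zeta.
- by rewrite regU rmorph1 scale1r word_poly_x1.
Qed.

(** [Zsh] is a choice among the shuffle regularizations: [reg] shows that there is one, and any two
    agree on H1. *)
Lemma ZshE f : H1 f -> Zsh R f = reg f.
Proof.
move=> Hf; apply: (regularization_unique _ reg_shuffle_regularization Hf).
by apply: (xgetPex (fun=> 0)); exists reg; exact: reg_shuffle_regularization.
Qed.

Lemma phi_log_series f : H1 f -> log_series 1 (phi (Defs.eta f)) (reg f).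
Proof.
move=> /H1P Hf; rewrite reg_sumE.
have H w : w \in msupp f ->
    log_series 1 (fun x => ratr f@_w * polylog w x) (ratr f@_w *: word_poly w).
  by move=> /Hf lw; apply: log_seriesZ; exact: word_poly_log_series.
apply: log_series_ext (log_series_sum H) => x _ x0.
rewrite /phi /Defs.eta raddf_sum big_seq [RHS]big_seq; apply: eq_bigr => w /Hf lw.
rewrite /= mmapU; congr (_ * _); case/word_of_compP: lw => s cs ->.
by rewrite word_of_compK // Li_expE.
Qed.

Lemma ZRB_plusE f : H1 f -> ZRB_plus R f = map_poly (real_complex R) (reg f).
Proof.
move=> Hf; apply: xget_unique.
  exact: log_series_regularized (phi_log_series Hf).
move=> p; exact: regularized_value_unique (phi_log_series Hf).
Qed.

(** [ZRB] splits off the component along the empty word; as [reg] is linear and maps the empty word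
    to 1, the two pieces recombine. *)
Lemma ZRBE f : H1 f -> ZRB R f = map_poly (real_complex R) (reg f).
Proof.
move=> Hf; have Hc : H1 (- << f@_([::] : word) *g [::] >>).
  by rewrite -scaleN1r; apply: H1Z; apply: H1U.
rewrite /ZRB ZRB_plusE; last exact: H1D.
rewrite regB regU word_poly_nil rmorphB /= alg_polyC map_polyC /= (fmorph_rat (real_complex R)).
by rewrite addrCA subrr addr0.
Qed.

End Regularization.

Theorem theorem4p7 (R : realType) :
  (forall f : Hsh, H1 f ->
     ZRB R f = map_poly (real_complex R) (Zsh R f)) /\
  (forall f : Hsh, H0 f ->
     ZRB R f = (real_complex R (zeta_sh R f))%:P).
Proof.
split=> f Hf; first by rewrite ZRBE // ZshE.
have Hf1 : H1 f by apply/H1P => w wf; have [] := (H0P f).1 Hf w wf.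
by rewrite ZRBE // reg_zeta // map_polyC.
Qed.
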